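(* Let $E\subset\mathbb{H}^n$ be a closed set with boundary $S$. Consider a sequence $\{p_i\}_{i\in\mathbb{N}}\subset\operatorname{Unp}(E)\setminus E$ converging to a point $p\in\operatorname{Unp}(E)\setminus E$. Assume that $\xi_E(p)$ is a regular point of $E$. Let $\{v_i\}_{i\in\mathbb{N}}$ be a sequence of initial tangent vectors to (arc-length parameterized) minimizing geodesics connecting $\xi_E(p_i)$ to $p_i$. Then $\lim_{i\to\infty}v_i=v(p)$, where $v(p)$ is the initial tangent vector at $\xi_E(p)$ of the unique minimizing geodesic connecting $\xi_E(p)$ to $p$. In particular, the function $q\mapsto v(q)$, assigning to $q\in\xi_E^{-1}(S\setminus S_0)\setminus E$ the initial tangent vector to the unique minimizing geodesic connecting $\xi_E(q)$ to $q$, is continuous in $\xi_E^{-1}(S\setminus S_0)\setminus E$.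
   Context: $\mathbb{H}^n$ is $\mathbb{R}^{2n+1}$ with coordinates $(x_1,y_1,\ldots,x_n,y_n,t)$, with the left-invariant vector fields $X_i=\partial_{x_i}+y_i\partial_t$, $Y_i=\partial_{y_i}-x_i\partial_t$ ($1\le i\le n$), $T=\partial_t$, and $n\ge 1$. The horizontal distribution $\mathcal{H}$ is spanned by the $X_i,Y_i$; $\langle\cdot,\cdot\rangle$ is the Riemannian metric making $\{X_i,Y_i,T\}$ orthonormal. $d$ is the Carnot-Carathéodory distance (infimum of Riemannian lengths of piecewise smooth curves tangent to $\mathcal{H}$); minimizing geodesics are curves with $d(\gamma(s),\gamma(s'))=|s-s'|$ (in $\mathbb{H}^n$ these are smooth and horizontal). $\operatorname{Unp}(E)$ is the set of points with a unique $d$-nearest point in $E$, and $\xi_E:\operatorname{Unp}(E)\to E$ sends a point to it. The tangent cone $\operatorname{Tan}(E,q)\subset T_q\mathbb{H}^n$ is the closed positively homogeneous set composed of the zero vector and the limits of tangent vectors at $q$ of $C^1$ curves starting from $q$ and contained in $E$; $q\in E$ is singular if $\operatorname{Tan}(E,q)$ is contained in one of the two closed half-spaces of $T_q\mathbb{H}^n$ determined by $\mathcal{H}_q$, and regular otherwise; $S_0$ is the set of singular points of $E$ in $S=\partial E$. When $p\in\operatorname{Unp}(E)\setminus E$ and $\xi_E(p)$ is regular, the minimizing geodesic connecting $\xi_E(p)$ to $p$ is unique. Convergence of tangent vectors is in the tangent bundle $T\mathbb{H}^n$. *)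

(* Defs.v *)
From HB Require Import structures.
From mathcomp Require Import all_boot all_order all_algebra.
From mathcomp Require Import all_classical all_reals all_analysis.
From mathcomp Require Import ring.

Set Implicit Arguments.
Unset Strict Implicit.
Unset Printing Implicit Defensive.

Import Order.TTheory GRing.Theory Num.Theory.
Import numFieldNormedType.Exports.

Local Open Scope classical_set_scope.
Local Open Scope ring_scope.

(* The point ((x, y), t) has coordinates (x_1, y_1, ..., x_n, y_n, t).
   The topology is the Euclidean one of R^(2n+1). *)
Notation heis R n := ('rV[R]_n * 'rV[R]_n * R)%type.

(* Tangent vectors are written in the coordinate basis
   (d/dx_i, d/dy_i, d/dt); this trivializes the tangent bundle, whose elements
   are pairs (base point, vector). *)
Notation tangent_bundle R n := (heis R n * heis R n)%type.

Section Heisenberg.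
Context {R : realType} {n : nat}.
Implicit Types (p q v w : heis R n) (E : set (heis R n)) (g : R -> heis R n).

Definition hx p (i : 'I_n) : R := p.1.1 ord0 i.
Definition hy p (i : 'I_n) : R := p.1.2 ord0 i.
Definition ht p : R := p.2.

Definition X_field (i : 'I_n) p : heis R n := (delta_mx ord0 i, 0, hy p i).
Definition Y_field (i : 'I_n) p : heis R n := (0, delta_mx ord0 i, - hx p i).
Definition T_field p : heis R n := (0, 0, 1).

Definition horizontal p v : Prop :=
  exists a b : 'I_n -> R,
    v = \sum_(i < n) a i *: X_field i p + \sum_(i < n) b i *: Y_field i p.

(* The T-component of v in the frame (X_i, Y_i, T) at p; the X_i- and
   Y_i-components are hx v i and hy v i (frame_decomposition below). *)
Definition T_coord p v : R :=
  ht v - \sum_(i < n) (hx v i * hy p i - hy v i * hx p i).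

Definition riem p v w : R :=
  \sum_(i < n) hx v i * hx w i + \sum_(i < n) hy v i * hy w i
  + T_coord p v * T_coord p w.

Definition riem_norm p v : R := Num.sqrt (riem p v v).

Definition smooth g : Prop := forall k t, derivable (derive1n k g) t 1.

(* Continuous, piecewise smooth and horizontal on [a, b]: on each closed
   interval of a finite partition, g is the restriction of a smooth curve of the
   whole line, with horizontal velocity on that interval. *)
Definition horizontal_curve (a b : R) g : Prop :=
  exists2 s : seq R, itv_partition a b s &
    forall i, (i < size s)%N ->
      exists2 h : R -> heis R n, smooth h &
        forall t, nth b (a :: s) i <= t <= nth b (a :: s) i.+1 ->
          g t = h t /\ horizontal (h t) (derive1 h t).

(* The velocity may fail to exist at the finitely many break points, which do
   not contribute to the integral. *)
Definition curve_length (a b : R) g : R :=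
  \int[lebesgue_measure]_(t in `[a, b]) riem_norm (g t) (derive1 g t).

Definition cc_dist p q : R :=
  inf [set l | exists a b g, [/\ horizontal_curve a b g, g a = p, g b = q
                               & l = curve_length a b g]].

(* Only the restriction of g to [0, L] is relevant. *)
Definition minimizing_geodesic q p g : Prop :=
  exists2 L : R, 0 <= L &
    [/\ g 0 = q, g L = p &
        forall s s', 0 <= s <= L -> 0 <= s' <= L ->
          cc_dist (g s) (g s') = `|s - s'|].

Definition initial_tangent g : tangent_bundle R n :=
  (g 0, lim ((fun h : R => h^-1 *: (g h - g 0)) @ 0^'+)).

Definition nearest E p q : Prop :=
  E q /\ forall q', E q' -> cc_dist p q <= cc_dist p q'.

Definition Unp E : set (heis R n) := [set p | exists! q, nearest E p q].

(* Meaningful on Unp E. *)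
Definition xi E p : heis R n := get [set q | nearest E p q].

Definition frontier E : set (heis R n) := closure E `\` interior E.

Definition C1 g : Prop := (forall t, derivable g t 1) /\ continuous (derive1 g).

(* A C^1 curve on [0, e[ extends, after decreasing e, to a C^1 curve defined on
   the whole line, hence the use of globally defined curves. *)
Definition tangent_vectors E q : set (heis R n) :=
  [set v | exists g (e : R), [/\ C1 g, 0 < e, g 0 = q,
             forall t, 0 <= t < e -> E (g t) & v = derive1 g 0]].

Definition Tan E q : set (heis R n) := 0 |` closure (tangent_vectors E q).

Definition upper_half_space q : set (heis R n) :=
  [set v | 0 <= riem q v (T_field q)].
Definition lower_half_space q : set (heis R n) :=
  [set v | riem q v (T_field q) <= 0].

Definition singular E q : Prop :=
  E q /\ (Tan E q `<=` upper_half_space q \/ Tan E q `<=` lower_half_space q).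

Definition regular E q : Prop := E q /\ ~ singular E q.

Definition S0 E : set (heis R n) := frontier E `&` [set q | singular E q].

(* Meaningful when p is in Unp E, outside E, with xi E p regular: there is then
   a minimizing geodesic from xi E p to p, unique on its interval [0, L]. *)
Definition init_vec E p : tangent_bundle R n :=
  initial_tangent (get [set g | minimizing_geodesic (xi E p) p g]).

Lemma frame_decomposition p v :
  v = \sum_(i < n) hx v i *: X_field i p + \sum_(i < n) hy v i *: Y_field i p
      + T_coord p v *: T_field p.
Proof.
have sumE (F : 'I_n -> heis R n) : \sum_(i < n) F i =
    (\sum_(i < n) (F i).1.1, \sum_(i < n) (F i).1.2, \sum_(i < n) (F i).2).
  have m1 := big_morph (fun u : heis R n => u.1.1)
    (id1 := 0) (op1 := +%R) (id2 := 0) (op2 := +%R) (fun _ _ => erefl) erefl.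
  have m2 := big_morph (fun u : heis R n => u.1.2)
    (id1 := 0) (op1 := +%R) (id2 := 0) (op2 := +%R) (fun _ _ => erefl) erefl.
  have m3 := big_morph (fun u : heis R n => u.2)
    (id1 := 0) (op1 := +%R) (id2 := 0) (op2 := +%R) (fun _ _ => erefl) erefl.
  by rewrite -m1 -m2 -m3; case: (\sum_i F i) => -[].
case: v => -[x y] t; rewrite !sumE; congr (_, _, _) => /=.
- rewrite scaler0 addr0 [X in _ + X]big1 ?addr0 => [|i _]; last exact: scaler0.
  exact: row_sum_delta.
- rewrite scaler0 addr0 [X in X + _]big1 ?add0r => [|i _]; last exact: scaler0.
  exact: row_sum_delta.
- rewrite /T_coord sumrB.
  rewrite [X in _ + X + _](eq_bigr (fun i => - (hy (x, y, t) i * hx p i))).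
    by rewrite sumrN /GRing.scale /= mulr1 /ht /=; ring.
  by move=> i _; exact: mulrN.
Qed.

Lemma T_coord_X p i : T_coord p (X_field i p) = 0.
Proof.
rewrite /T_coord (bigD1 i) //= big1 => [|j ji].
  by rewrite /hx /hy /= !mxE !eqxx mul1r mul0r subr0 addr0 subrr.
by rewrite /hx /hy /= !mxE eqxx (negbTE ji) !mul0r subr0.
Qed.

Lemma T_coord_Y p i : T_coord p (Y_field i p) = 0.
Proof.
rewrite /T_coord (bigD1 i) //= big1 => [|j ji].
  by rewrite /hx /hy /= !mxE !eqxx mul1r mul0r sub0r addr0 subrr.
by rewrite /hx /hy /= !mxE eqxx (negbTE ji) !mul0r subr0.
Qed.

Lemma T_coord_T p : T_coord p (T_field p) = 1.
Proof.
rewrite /T_coord big1 ?subr0 // => j _.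
by rewrite /hx /hy /= !mxE !mul0r subr0.
Qed.

Lemma riem_orthonormal p i j :
  [/\ riem p (X_field i p) (X_field j p) = (i == j)%:R,
      riem p (Y_field i p) (Y_field j p) = (i == j)%:R &
      riem p (T_field p) (T_field p) = 1] /\
  [/\ riem p (X_field i p) (Y_field j p) = 0,
      riem p (X_field i p) (T_field p) = 0 &
      riem p (Y_field i p) (T_field p) = 0].
Proof.
have s0 (F G : 'I_n -> R) : (forall k, F k = 0) \/ (forall k, G k = 0) ->
    \sum_(k < n) F k * G k = 0.
  by move=> FG; rewrite big1 // => k _; case: FG => ->; rewrite ?mul0r ?mulr0.
have sd : \sum_(k < n) (delta_mx ord0 i : 'rV[R]_n) ord0 k *
    (delta_mx ord0 j : 'rV[R]_n) ord0 k = (i == j)%:R.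
  rewrite (bigD1 i) //= big1 => [|k ki].
    by rewrite !mxE !eqxx mul1r addr0.
  by rewrite !mxE (negbTE ki) mul0r.
have z k : (0 : 'rV[R]_n) ord0 k = 0 by rewrite mxE.
rewrite /riem !T_coord_X !T_coord_Y !T_coord_T /hx /hy /= sd.
by split; split; rewrite ?s0 ?(mulr0, mul0r, mulr1, addr0, add0r) //;
  ((by left) || (by right)).
Qed.

End Heisenberg.

(* Main.v *)
From HB Require Import structures.
Require Import Defs.
From mathcomp Require Import all_boot all_order all_algebra.
From mathcomp Require Import all_classical all_reals all_analysis.
From mathcomp Require Import measurable_realfun ring lra.

Set Implicit Arguments.
Unset Strict Implicit.
Unset Printing Implicit Defensive.

Import Order.TTheory GRing.Theory Num.Theory.
Import numFieldNormedType.Exports.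

Local Open Scope classical_set_scope.
Local Open Scope ring_scope.

(** In the Heisenberg group q^-1 p is the point (Z, t) that [ldiv q p]
    computes, with Z in R^(2n) and t real, and [sqn] is |Z|^2. Left
    translations preserve horizontality and length, so the distance from q to
    p depends on (Z, t) only, and a horizontal curve is a curve in R^(2n)
    together with the symplectic area that it sweeps. The proof rests on
    Gaveau's formula

      d(q, p)^2 = sup { 2 phi t + phi cot(phi) |Z|^2 : |phi| < pi }.

    The function under the supremum is [gaveau phi]; for Z <> 0 the supremum
    is attained at the only angle phi in ]-pi, pi[ with psi(phi) = t / |Z|^2,
    where [psi] is continuous and strictly increasing, and for Z = 0 it is 2
    pi |t|. The lower bound is a calibration: with mu = phi / d and c a
    solution of the Riccati equation c' = - (c^2 + mu^2), the function 2 mu t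
    + c(s) |z|^2 grows along a horizontal curve at most as fast as the arc
    length s ([calibration_smooth], [calibration_curve]). The upper bound
    comes from lifted circular arcs ([harc]), which realise equality
    ([harc_to], [harc_to_vertical]).

    A minimizing geodesic is only a curve that is isometric to an interval, so
    its tangent has to be extracted from the formula. If m lies between q and
    p, at distances s and s' with s + s' = d(q, p), then the lower bounds for
    (q, m) and (m, p) and the equality for (q, p), all taken at the same
    frequency mu, add up to the vanishing of a sum of squares ([sqr_ldivM],
    [geodesic_rigidity]), and this determines the horizontal coordinates of m
    as explicit functions of s. Dividing by s and letting s tend to 0, every
    minimizing geodesic from q to p with Z <> 0 has the initial vector

      (phi cot(phi) Z - phi J Z) / d(q, p),      J (x, y) = (y, - x),

    lifted horizontally at q ([initial_tangentE]). This formula contains the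
    uniqueness of the initial vector, and it is continuous in (q, p) where Z
    <> 0, since phi depends continuously on t / |Z|^2 ([cvg_init_dir]).

    Regularity of q = xi(p) excludes Z = 0. If p lies vertically above q, then
    a curve that leaves q with positive vertical speed gains to first order in
    2 pi |t| while it loses only to second order in |Z|^2, so it comes closer
    to p than q and cannot stay in E; hence the tangent cone lies in a
    half-space ([vertical_singular]).

    The points xi(p') stay in a compact set for p' near p, the distance is
    lower semicontinuous as a supremum of continuous functions, it is
    continuous at (p, q) as Z <> 0, and q is the only nearest point; so xi is
    continuous at p ([xi_near]). Composing xi with the formula for the initial
    vector proves both assertions ([cvg_initial_tangent]). *)

(** * Elementary trigonometric functions *)

Section Trigonometry.
Context {R : realType}.
Implicit Types (a b x y k : R) (f df : R -> R).

Lemma is_derive_le f df a b : a <= b ->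
  (forall x, x \in `[a, b] -> is_derive x 1 f (df x)) ->
  (forall x, x \in `[a, b] -> 0 <= df x) -> f a <= f b.
Proof.
move=> ab fdf df0.
have cf : {within `[a, b], continuous f}.
  by apply: derivable_within_continuous => x xab; have [] := fdf x xab.
have fdf' x : x \in `]a, b[%R -> is_derive x 1 f (df x).
  by move=> xab; apply/fdf/subset_itv_oo_cc.
have [c cab E] := MVT_segment ab fdf' cf.
by rewrite -subr_ge0 E mulr_ge0 ?subr_ge0 ?df0.
Qed.

Lemma is_derive_lt f df a b : a < b ->
  (forall x, x \in `[a, b] -> is_derive x 1 f (df x)) ->
  (forall x, x \in `]a, b[ -> 0 < df x) -> f a < f b.
Proof.
move=> ab fdf df0.
have cf : {within `[a, b], continuous f}.
  by apply: derivable_within_continuous => x xab; have [] := fdf x xab.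
have fdf' x : x \in `]a, b[%R -> is_derive x 1 f (df x).
  by move=> xab; apply/fdf/subset_itv_oo_cc.
have [c cab E] := MVT ab fdf' cf.
by rewrite -subr_gt0 E mulr_gt0 ?subr_gt0 ?df0.
Qed.

Lemma sin_neq0 x : x != 0 -> `|x| < pi -> sin x != 0.
Proof.
move=> x0; rewrite ltr_norml => /andP[x1 x2]; have [x3|x3|/eqP] := ltgtP x 0.
- rewrite -oppr_eq0 -sinN gt_eqF// sin_gt0_pi//; apply/andP; split; lra.
- by rewrite gt_eqF// sin_gt0_pi// x3.
- by rewrite (negbTE x0).
Qed.

Lemma sin_le x : 0 <= x -> sin x <= x.
Proof.
move=> x0; have : (0 : R) - sin 0 <= x - sin x.
  apply: (@is_derive_le (fun y => y - sin y) (fun y => 1 - cos y) 0 x) => //.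
by rewrite sin0 subr0 subr_ge0.
Qed.

Lemma mulr_cos_lt_sin x : 0 < x -> x < pi -> x * cos x < sin x.
Proof.
move=> x0 xpi; have : sin 0 - (0 : R) * cos 0 < sin x - x * cos x.
  apply: (@is_derive_lt (fun y => sin y - y * cos y) (fun y => y * sin y) 0 x)
    => //.
    move=> y _; apply: is_derive_eq; rewrite /GRing.scale/=; ring.
  move=> y; rewrite in_itv/= => /andP[y0 yx].
  by rewrite mulr_gt0 ?sin_gt0_pi// y0 (lt_trans yx).
by rewrite sin0 mul0r subr0 subr_gt0.
Qed.

Lemma sinMcos_lt x : 0 < x -> x < pi -> sin x * cos x < x.
Proof.
move=> x0 xpi; have : (0 : R) - sin 0 * cos 0 < x - sin x * cos x.
  apply: (@is_derive_lt (fun y => y - sin y * cos y)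
                        (fun y => 2 * sin y ^+ 2) 0 x) => //.
    move=> y _; apply: is_derive_eq; rewrite /GRing.scale/=.
    by move: (cos2Dsin2 y) => ?; nra.
  move=> y; rewrite in_itv/= => /andP[y0 yx].
  by rewrite mulr_gt0 ?exprn_gt0 ?sin_gt0_pi// y0 (lt_trans yx).
by rewrite sin0 mul0r subr0 subr_gt0.
Qed.

(** The function x cot x, extended continuously by 1 at 0. *)
Definition chi x := if x == 0 then 1 else x * cos x / sin x.

Lemma chiN x : chi (- x) = chi x.
Proof.
rewrite /chi oppr_eq0 cosN sinN; case: ifPn => // _.
by rewrite invrN mulrN !mulNr opprK.
Qed.

Lemma chi_le1 x : `|x| < pi -> chi x <= 1.
Proof.
wlog x0 : x / 0 <= x => [H|].
  have [|/ltW x0 xp] := leP 0 x; first exact: H.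
  by rewrite -chiN; apply: H; rewrite ?oppr_ge0 ?normrN.
rewrite ger0_norm// /chi; case: eqVneq => // xn0 xp.
have {}x0 : 0 < x by rewrite lt_neqAle eq_sym xn0.
by rewrite ler_pdivrMr ?sin_gt0_pi ?x0// mul1r ltW ?mulr_cos_lt_sin.
Qed.

(** Together with [chi_le1] this squeezes [chi] at 0. *)
Lemma cos_le_chi x : `|x| < pi / 2 -> cos x <= chi x.
Proof.
wlog x0 : x / 0 <= x => [H|].
  have [|/ltW x0 xp] := leP 0 x; first exact: H.
  by rewrite -chiN -cosN; apply: H; rewrite ?oppr_ge0 ?normrN.
rewrite ger0_norm// /chi; case: eqVneq => [->|xn0 xp]; first by rewrite cos0.
have {}x0 : 0 < x by rewrite lt_neqAle eq_sym xn0.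
have pi0 := pi_gt0 R.
have s0 : 0 < sin x by apply: sin_gt0_pi; apply/andP; split => //; lra.
rewrite ler_pdivlMr// mulrC ler_wpM2r ?sin_le ?(ltW x0)//.
by apply: cos_ge0_pihalf; apply/andP; split; lra.
Qed.

Lemma continuous_chi x : `|x| < pi -> chi y @[y --> x] --> chi x.
Proof.
move=> xpi; have pi0 := pi_gt0 R; have [->|x0] := eqVneq x 0.
  have chi0 : chi 0 = 1 by rewrite /chi eqxx.
  rewrite chi0.
  have near0 : \forall y \near (0 : R), cos y <= chi y <= 1.
    have p2 : 0 < pi / 2 :> R by lra.
    have p3 : pi / 2 < pi :> R by lra.
    have h2 : \forall y \near (0 : R), `|y| < pi / 2 by exact: nbhs0_lt.
    near=> y; have y2 : `|y| < pi / 2.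
      near: y; exact: h2.
    by rewrite cos_le_chi//= chi_le1 ?(lt_trans y2).
  apply: (squeeze_cvgr near0); last exact: cvg_cst.
  by rewrite -[X in _ --> X]cos0; exact: continuous_cos.
have E : {near x, (fun y => y * cos y / sin y) =1 chi}.
  have nx : \forall y \near x, y != 0 by exact: (@cvgr_neq0 _ _ _ (nbhs x) _
    id x cvg_id x0).
  by near=> y; rewrite /chi ifN//; near: y.
have chix : chi x = x * cos x / sin x by rewrite /chi (negbTE x0).
rewrite chix.
apply: cvg_trans; first exact: (near_eq_cvg E).
apply: cvgM; first by apply: cvgM; [exact: cvg_id|exact: continuous_cos].
by apply: cvgV; [exact: sin_neq0|exact: continuous_sin].
Unshelve. all: by end_near. Qed.

(** For a planar circular arc of angle 2 x, half the opposite of the derivative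
    of x cot x; it is the ratio between twice the area swept and the squared
    chord. At 0 the conventional value of 0 / 0 is the right one. *)
Definition psi x := (x - sin x * cos x) / (2 * sin x ^+ 2).

Lemma psiN x : psi (- x) = - psi x.
Proof. by rewrite /psi sinN cosN sqrrN mulNr -opprD mulNr. Qed.

Lemma psi0 : psi 0 = 0.
Proof. by rewrite /psi sin0 mul0r subr0 mul0r. Qed.

Lemma psi_gt0 x : 0 < x -> x < pi -> 0 < psi x.
Proof.
move=> x0 xp; rewrite /psi divr_gt0 ?subr_gt0 ?sinMcos_lt//.
by rewrite mulr_gt0// exprn_gt0// sin_gt0_pi ?x0.
Qed.

(** On ]0, pi[ the derivative of [psi] is (sin x - x cos x) / sin^3 x > 0, and
    [psi] is odd and vanishes at 0, where the quotient is not differentiated.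
    *)
Lemma psi_lt x y : `|x| < pi -> `|y| < pi -> x < y -> psi x < psi y.
Proof.
have pos a b : 0 < a -> a < b -> b < pi -> psi a < psi b.
  move=> a0 ab bp.
  have s0 z : a <= z -> z <= b -> 0 < sin z.
    by move=> az zb; apply: sin_gt0_pi;
      rewrite (lt_le_trans a0) ?(le_lt_trans zb).
  apply: (@is_derive_lt psi (fun y => (sin y - y * cos y) / sin y ^+ 3) a b)
    => //.
    move=> z; rewrite in_itv/= => /andP[az zb].
    have sz := s0 z az zb; have n0 : 2 * sin z ^+ 2 != 0.
      by rewrite mulf_neq0 ?expf_neq0 ?gt_eqF.
    have dV : is_derive z 1 (fun y => (2 * sin y ^+ 2)^-1)
                      (- (2 * sin z ^+ 2) ^- 2 * (4 * sin z * cos z)).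
      apply: is_derive_eq; rewrite /GRing.scale/=; ring.
    apply: is_derive_eq; rewrite /GRing.scale/=.
    have : cos z ^+ 2 = 1 - sin z ^+ 2 by rewrite -(cos2Dsin2 z); ring.
    move=> cE; apply/eqP; rewrite -subr_eq0; apply/eqP.
    have -> : (z - sin z * cos z) *
      (- (2 * sin z ^+ 2) ^- 2 * (4 * sin z * cos z)) +
      (2 * sin z ^+ 2)^-1 * (1 - (sin z * - sin z + cos z * cos z)) -
      (sin z - z * cos z) / sin z ^+ 3 =
      (sin z ^+ 2 + cos z ^+ 2 - 1) / (2 * sin z ^+2).
      by field; rewrite gt_eqF.
    by rewrite cE; ring.
  move=> z; rewrite in_itv/= => /andP[az zb].
  rewrite divr_gt0 ?exprn_gt0 ?s0 ?ltW// subr_gt0 mulr_cos_lt_sin//.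
    exact: lt_trans az.
  exact: lt_trans bp.
rewrite !ltr_norml => /andP[x1 x2] /andP[y1 y2] xy.
have [x0|x0|x0] := ltgtP 0 x; first exact: pos.
- have [y0|y0|<-] := ltgtP 0 y.
  + apply: (@lt_trans _ _ 0); last exact: psi_gt0.
    by rewrite -oppr_gt0 -psiN psi_gt0//; lra.
  + by rewrite -ltrN2 -!psiN; apply: pos; lra.
  + by rewrite psi0 -oppr_gt0 -psiN psi_gt0//; lra.
- by rewrite -x0 psi0 psi_gt0// x0.
Qed.

(** Intermediate value theorem for the numerator of k - psi, which avoids the
    singularities of [psi] at 0 and pi: it is positive at atan k, because x cos
    x < sin x, and negative at pi. *)
Lemma psi_surj k : exists2 x, `|x| < pi & psi x = k.
Proof.
have pi0 := pi_gt0 R.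
wlog k0 : k / 0 < k => [H|].
  have [| /[!(@ltNge _ _ k)] |<-] := ltgtP 0 k; [exact: H| |].
    rewrite -ltNge -oppr_gt0 => /H[x xp xk]; exists (- x);
      first by rewrite normrN.
    by rewrite psiN xk opprK.
  by exists 0; rewrite ?psi0 ?normr0.
pose f x := 2 * k * sin x ^+ 2 - (x - sin x * cos x).
have [a0 a2] : 0 < atan k /\ atan k < pi / 2.
  by split; [rewrite -[ltLHS](@atan0 R) lt_atan|exact: atan_ltpi2].
have s0 : 0 < sin (atan k) by apply: sin_gt0_pi; apply/andP; split; lra.
have c0 : 0 < cos (atan k) by apply: cos_gt0_pihalf; apply/andP; split; lra.
have fa : 0 < f (atan k).
  have : sin (atan k) = k * cos (atan k).
    by rewrite -{2}(atanK k) /tan -mulrA mulVf ?mulr1 ?gt_eqF.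
  have := @mulr_cos_lt_sin (atan k) a0 ltac:(lra).
  have := cos2Dsin2 (atan k); rewrite /f.
  set s := sin _; set c := cos _; set a := atan k => cs ac sk.
  have : a < k by rewrite -(ltr_pM2r c0) -sk.
  have -> : s ^+ 2 = k * (s * c) by rewrite expr2 {2}sk; ring.
  have -> : 2 * k * (k * (s * c)) - (a - s * c) = (2 * k ^+2 + 1) * (s * c) - a.
    by ring.
  have k1 : (k ^+ 2 + 1) * c ^+ 2 = 1 by rewrite -[RHS]cs sk; ring.
  have -> : (2 * k ^+ 2 + 1) * (s * c) = k + k * (k ^+2 * c^+2).
    rewrite sk; have -> : k + k * (k ^+ 2 * c ^+ 2) =
       k * ((k ^+ 2 + 1) * c ^+ 2) + k * (k ^+ 2 * c ^+ 2) by rewrite k1; ring.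
    ring.
  have : 0 < k * (k ^+ 2 * c ^+ 2) by rewrite !mulr_gt0 ?exprn_gt0.
  lra.
have fp : f pi < 0 by rewrite /f sinpi; lra.
have [|||c] := @IVT R f (atan k) pi 0.
- by lra.
- apply/continuous_subspaceT => x; apply/differentiable_continuous.
  by apply/derivable1_diffP.
- by rewrite ge_min le_max (ltW fa) (ltW fp) orbT.
rewrite in_itv/= => /andP[ac cp] fc.
have {}cp : c < pi.
  rewrite lt_neqAle cp andbT; apply/eqP => cE; move: fp; rewrite -cE fc; lra.
have cs : 0 < sin c by rewrite sin_gt0_pi// cp (lt_le_trans a0).
exists c; first by rewrite ger0_norm// ltW// (lt_le_trans a0).
rewrite /psi; apply: (canLR (mulfK _));
  first by rewrite mulf_neq0 ?expf_neq0 ?gt_eqF.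
by move: fc; rewrite /f; lra.
Qed.

End Trigonometry.

(** * Calculus on the line *)

Section Calculus.
Context {R : realType}.
Notation mu := (@lebesgue_measure R).

Lemma is_derive_linear (V W : normedModType R) (f : {linear V -> W})
    (h : R -> V) (t : R) (v : V) :
  continuous f -> is_derive t 1 h v -> is_derive t 1 (f \o h) (f v).
Proof.
move=> cf [dh <-].
have dh' : differentiable h t by apply/derivable1_diffP.
have df : differentiable f (h t) by exact: linear_differentiable.
have dfh : differentiable (f \o h) t by exact: differentiable_comp.
apply: DeriveDef; first exact/derivable1_diffP.
by rewrite !deriveE// diff_comp//= diff_lin.
Qed.

(** The integral is started at c - 1 so that the primitive is differentiable at
    the end point c too. *)
Lemma continuous_antiderivative (f : R -> R) (c c' : R) :
  continuous f -> c <= c' ->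
  exists2 F : R -> R, (forall t, t \in `[c, c'] -> is_derive t 1 F (f t)) &
    F c' - F c = \int[mu]_(t in `[c, c']) f t.
Proof.
move=> cf cc.
have itf a b : mu.-integrable `[a, b] (EFin \o f).
  apply: continuous_compact_integrable; first exact: segment_compact.
  exact: continuous_subspaceT.
exists (fun x => \int[mu]_(t in `[c - 1, x]) f t).
  move=> t; rewrite in_itv/= => /andP[ct tc].
  have [||] := @continuous_FTC1_closed R f (c - 1) t (t + 1) _ (itf _ _) _ (cf
    t).
  - by rewrite ltrDl.
  - by rewrite ltrBlDr (le_lt_trans ct)// ltrDl.
  by move=> dF <-; rewrite derive1E; exact: derivableP.
rewrite Rintegral_itvB//.
  by rewrite Rintegral_itv_obnd_cbnd//; apply: integrableS (itf c c') => //;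
    exact: subset_itv_oc_cc.
by rewrite bnd_simp lerBlDr lerDl.
Qed.

(** Transfers integrability from a smooth piece to the curve, whose velocity
    may not exist at the break points. *)
Lemma integrable_itv_eq_oo (f g : R -> R) (c c' : R) :
  (forall t, c < t < c' -> f t = g t) ->
  mu.-integrable `[c, c'] (EFin \o g) ->
  mu.-integrable `[c, c'] (EFin \o f) /\
  \int[mu]_(t in `[c, c']) f t = \int[mu]_(t in `[c, c']) g t.
Proof.
move=> fg ig.
have ig' : mu.-integrable `]c, c'[ (EFin \o g).
  by apply: integrableS ig => //; exact: subset_itv_oo_cc.
have if' : mu.-integrable `]c, c'[ (EFin \o f).
  apply: eq_integrable ig' => // t; rewrite inE/= in_itv/= => tc.
  by rewrite /= fg.
have mf := measurable_int mu if'; have mg := measurable_int mu ig'.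
split; last first.
  rewrite /Rintegral (integral_itv_bndoo true false mf).
  rewrite (integral_itv_bndoo true false mg); congr fine.
  by apply: eq_integral => t; rewrite inE/= in_itv/= => tc; rewrite /= fg.
apply/integrableP; split.
  apply/emeasurable_fun_itv_bndo_bndcP.
  exact/emeasurable_fun_itv_obnd_cbndP.
rewrite integral_itv_bndoo; last exact: measurableT_comp.
by move/integrableP : if' => [].
Qed.

Lemma integrable_itv_cat (f : R -> R) (a x b : R) : a <= x -> x <= b ->
  mu.-integrable `[a, x] (EFin \o f) -> mu.-integrable `[x, b] (EFin \o f) ->
  mu.-integrable `[a, b] (EFin \o f) /\
  \int[mu]_(t in `[a, b]) f t =
    \int[mu]_(t in `[a, x]) f t + \int[mu]_(t in `[x, b]) f t.
Proof.
move=> ax xb iax ixb.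
have ixb' : mu.-integrable `]x, b] (EFin \o f).
  by apply: integrableS ixb => //; exact: subset_itv_oc_cc.
have U : `[a, b]%classic = `[a, x]%classic `|` `]x, b]%classic.
  by apply: itv_bndbnd_setU; rewrite bnd_simp.
have dis : [disjoint `[a, x]%classic & `]x, b]%classic].
  apply/disj_setPS => y [/=]; rewrite 2!in_itv/= => /andP[_ yx] /andP[].
  by rewrite ltNge yx.
have iab : mu.-integrable `[a, b] (EFin \o f).
  have [/integrableP[m1 l1] /integrableP[m2 l2]] := conj iax ixb'.
  have mU : measurable_fun (`[a, x]%classic `|` `]x, b]%classic) (EFin \o f).
    by apply/measurable_funU => //; split.
  apply/integrableP; split; rewrite U//.
  rewrite ge0_integral_setU//=; first exact: lte_add_pinfty.
  by do 2 apply: measurableT_comp => //; exact/measurable_EFinP.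
split => //; rewrite U Rintegral_setU//; last by rewrite -U.
by rewrite Rintegral_itv_obnd_cbnd.
Qed.

End Calculus.

(** * Algebra of the Heisenberg group *)

Section HeisenbergGroup.
Context {R : realType} {n : nat}.
Implicit Types (p q m v w : heis R n) (c s mu : R).

(** The area form: a curve with velocity v at p is horizontal when its vertical
    velocity is [sympl v p]. *)
Definition sympl p q : R := \sum_(i < n) (hx p i * hy q i - hy p i * hx q i).
Definition sqn p : R := \sum_(i < n) (hx p i ^+ 2 + hy p i ^+ 2).
(** The point q^-1 p for the group law (z, t) (w, u) = (z + w, t + u + sympl w
    z), for which the fields X_i, Y_i and T are left-invariant. *)
Definition ldiv q p : heis R n :=
  (p.1.1 - q.1.1, p.1.2 - q.1.2, ht p - ht q - sympl p q).

Lemma hx_ldiv q p i : hx (ldiv q p) i = hx p i - hx q i.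
Proof. by rewrite /hx !mxE. Qed.

Lemma hy_ldiv q p i : hy (ldiv q p) i = hy p i - hy q i.
Proof. by rewrite /hy !mxE. Qed.

Lemma ht_ldiv q p : ht (ldiv q p) = ht p - ht q - sympl p q.
Proof. by []. Qed.

Lemma sympl_ldivr v q p : sympl v (ldiv q p) = sympl v p - sympl v q.
Proof.
rewrite /sympl -sumrB; apply: eq_bigr => i _.
by rewrite hx_ldiv hy_ldiv; ring.
Qed.

Lemma sqn_ge0 p : 0 <= sqn p.
Proof. by apply: sumr_ge0 => i _; rewrite addr_ge0 ?sqr_ge0. Qed.

Lemma sqn_eq0 p : sqn p = 0 -> forall i, hx p i = 0 /\ hy p i = 0.
Proof.
move=> /eqP p0 i; move: p0; rewrite psumr_eq0 => [|j _]; last first.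
  by rewrite addr_ge0 ?sqr_ge0.
move=> /allP/(_ _ (mem_index_enum i)).
by rewrite paddr_eq0 ?sqr_ge0// !sqrf_eq0 => /andP[/eqP ? /eqP ?].
Qed.

Lemma sqn_ldivC p q : sqn (ldiv q p) = sqn (ldiv p q).
Proof.
by apply: eq_bigr => i _; rewrite !hx_ldiv !hy_ldiv; ring.
Qed.

Lemma symplC p q : sympl p q = - sympl q p.
Proof. by rewrite /sympl -sumrN; apply: eq_bigr => i _; ring. Qed.

Lemma sympl_diag p : sympl p p = 0.
Proof. by have := symplC p p; lra. Qed.

Lemma ht_ldivC p q : ht (ldiv q p) = - ht (ldiv p q).
Proof. by rewrite !ht_ldiv (symplC q p); ring. Qed.

Lemma sqn_ldivv q : sqn (ldiv q q) = 0.
Proof.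
by apply: big1 => i _; rewrite hx_ldiv hy_ldiv !subrr expr0n addr0.
Qed.

Lemma ht_ldivv q : ht (ldiv q q) = 0.
Proof. by rewrite ht_ldiv sympl_diag !subrr. Qed.

(** The cocycle relation of the vertical coordinate: (q^-1 m) (m^-1 p) = q^-1
    p. *)
Lemma ht_ldivM q m p :
  ht (ldiv q p) = ht (ldiv q m) + ht (ldiv m p) + sympl (ldiv m p) (ldiv q m).
Proof.
rewrite !ht_ldiv; have -> : sympl (ldiv m p) (ldiv q m) =
    sympl p m - sympl p q + sympl m q.
  rewrite /sympl -sumrB -big_split; apply: eq_bigr => i _ /=.
  by rewrite !hx_ldiv !hy_ldiv; ring.
by ring.
Qed.

(** The completed square behind everything that follows: writing z, z' for the
    horizontal parts of q^-1 m and m^-1 p, the left-hand side is |(c + c') z -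
    (c' - mu J) (z + z')|^2. *)
Lemma sqr_ldivM c c' mu q m p :
  (c + c') * (c * sqn (ldiv q m) + c' * sqn (ldiv m p)) -
    (c * c' - mu ^+ 2) * sqn (ldiv q p) -
    2 * mu * (c + c') * sympl (ldiv m p) (ldiv q m) =
  \sum_(i < n)
    (((c + c') * (hx m i - hx q i)
      - (c' * (hx p i - hx q i) - mu * (hy p i - hy q i))) ^+ 2 +
     ((c + c') * (hy m i - hy q i)
      - (c' * (hy p i - hy q i) + mu * (hx p i - hx q i))) ^+ 2).
Proof.
rewrite /sqn /sympl mulrDr !mulr_sumr -big_split -!sumrB;
  apply: eq_bigr => i _ /=.
by rewrite !hx_ldiv !hy_ldiv; ring.
Qed.

(** With C = (c c' - mu^2) / (c + c'), as in the addition formula of the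
    cotangent, equality in the triangle inequality forces the square of
    [sqr_ldivM] to vanish. *)
Lemma geodesic_rigidity c c' C mu s s' q m p :
  0 < c + c' -> C * (c + c') = c * c' - mu ^+ 2 ->
  2 * mu * ht (ldiv q m) + c * sqn (ldiv q m) <= s ->
  2 * mu * ht (ldiv m p) + c' * sqn (ldiv m p) <= s' ->
  2 * mu * ht (ldiv q p) + C * sqn (ldiv q p) = s + s' ->
  forall i,
   (c + c') * (hx m i - hx q i) = c' * (hx p i - hx q i) - mu * (hy p i - hy q
     i)
   /\
   (c + c') * (hy m i - hy q i) = c' * (hy p i - hy q i) + mu * (hx p i - hx q
     i).
Proof.
move=> cc0 CE hs hs' hT.
set F := fun i => ((c + c') * (hx m i - hx q i)
      - (c' * (hx p i - hx q i) - mu * (hy p i - hy q i))) ^+ 2 +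
     ((c + c') * (hy m i - hy q i)
      - (c' * (hy p i - hy q i) + mu * (hx p i - hx q i))) ^+ 2.
have F0 i : 0 <= F i by rewrite addr_ge0 ?sqr_ge0.
have : \sum_(i < n) F i <= 0.
  rewrite -sqr_ldivM -CE; move: hT; rewrite (ht_ldivM q m p) => hT.
  have : c * sqn (ldiv q m) + c' * sqn (ldiv m p) - C * sqn (ldiv q p)
      - 2 * mu * sympl (ldiv m p) (ldiv q m) <= 0 by lra.
  by rewrite -(pmulr_rle0 _ cc0); apply: le_trans; rewrite le_eqVlt;
    apply/orP; left;
    apply/eqP; ring.
move=> S0; have /eqP : \sum_(i < n) F i = 0.
  by apply/eqP; rewrite eq_le S0 sumr_ge0.
rewrite psumr_eq0 => [/allP FE i|//].
have /eqP := FE i (mem_index_enum i).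
move/eqP; rewrite paddr_eq0 ?sqr_ge0// !sqrf_eq0 !subr_eq0.
by move=> /andP[/eqP ? /eqP ?].
Qed.

(** The left-hand side is 2 <v, w> for a vector w with |w|^2 = (c^2 + mu^2)
    |m|^2, and 2 <v, w> <= r (1 + |w|^2) when |v| = r. *)
Lemma calibration_bound c mu (r : R) v m : 0 <= r -> r ^+ 2 = sqn v ->
  2 * mu * sympl v m +
    c * (2 * \sum_(i < n) (hx m i * hx v i + hy m i * hy v i)) <=
  r * (1 + (c ^+ 2 + mu ^+ 2) * sqn m).
Proof.
move=> r0 rE; rewrite -mulrA (mulrCA c) -mulrDr; set P := _ + _.
have PE : P = \sum_(i < n) (hx v i * (c * hx m i + mu * hy m i)
   + hy v i * (c * hy m i - mu * hx m i)).
  rewrite /P /sympl !mulr_sumr -big_split; apply: eq_bigr => i _ /=; ring.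
have [r00|rn0] := eqVneq r 0.
  have v0 : forall i, hx v i = 0 /\ hy v i = 0.
    by apply: sqn_eq0; rewrite -rE r00 expr0n.
  rewrite r00 mul0r PE big1 ?mulr0// => i _.
  by have [-> ->] := v0 i; rewrite !mul0r addr0.
have {}r0 : 0 < r by rewrite lt_neqAle eq_sym rn0.
rewrite -(ler_pM2l r0) -subr_ge0.
have -> : r * (r * (1 + (c ^+ 2 + mu ^+ 2) * sqn m)) - r * (2 * P) =
  \sum_(i < n) ((r * (c * hx m i + mu * hy m i) - hx v i) ^+ 2 +
      (r * (c * hy m i - mu * hx m i) - hy v i) ^+ 2).
  have -> : r * (r * (1 + (c ^+ 2 + mu ^+ 2) * sqn m)) =
    sqn v + r ^+ 2 * (c ^+ 2 + mu ^+ 2) * sqn m by rewrite -rE; ring.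
  rewrite PE /sqn !mulr_sumr -big_split -sumrB; apply: eq_bigr => i _ /=; ring.
by apply: sumr_ge0 => i _; rewrite addr_ge0 ?sqr_ge0.
Qed.

End HeisenbergGroup.

(** * Derivatives and limits in coordinates *)

Section HeisenbergCalculus.
Context {R : realType} {n : nat}.
Implicit Types (p q m v w : heis R n) (g h : R -> heis R n) (t : R).

Lemma hx_is_linear i : linear (fun p : heis R n => hx p i : R).
Proof. by move=> a p q; rewrite /hx /= !mxE. Qed.

Lemma hy_is_linear i : linear (fun p : heis R n => hy p i : R).
Proof. by move=> a p q; rewrite /hy /= !mxE. Qed.

Lemma ht_is_linear : linear (@ht R n : heis R n -> R).
Proof. by []. Qed.

Lemma continuous_hx i : continuous (fun p : heis R n => hx p i).
Proof.
move=> p; apply: (@cvg_comp _ _ _ (fun p : heis R n => p.1.1) (fun z => z ord0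
  i)
  _ (nbhs p.1.1)); last exact: coord_continuous.
by apply: (@cvg_comp _ _ _ fst fst (nbhs p) (nbhs p.1)); exact: cvg_fst.
Qed.

Lemma continuous_hy i : continuous (fun p : heis R n => hy p i).
Proof.
move=> p; apply: (@cvg_comp _ _ _ (fun p : heis R n => p.1.2) (fun z => z ord0
  i)
  _ (nbhs p.1.2)); last exact: coord_continuous.
by apply: (@cvg_comp _ _ _ fst snd (nbhs p) (nbhs p.1));
  [exact: cvg_fst|exact: cvg_snd].
Qed.

Lemma continuous_ht : continuous (@ht R n).
Proof. by move=> p; exact: cvg_snd. Qed.

Lemma is_derive_hx h t v i :
  is_derive t 1 h v -> is_derive t 1 (fun s => hx (h s) i) (hx v i).
Proof.
pose f : {linear heis R n -> R} :=
  HB.pack (fun p : heis R n => hx p i : R) (GRing.isLinear.Build _ _ _ _ _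
    (hx_is_linear i)).
by apply: (@is_derive_linear R _ _ f); exact: continuous_hx.
Qed.

Lemma is_derive_hy h t v i :
  is_derive t 1 h v -> is_derive t 1 (fun s => hy (h s) i) (hy v i).
Proof.
pose f : {linear heis R n -> R} :=
  HB.pack (fun p : heis R n => hy p i : R) (GRing.isLinear.Build _ _ _ _ _
    (hy_is_linear i)).
by apply: (@is_derive_linear R _ _ f); exact: continuous_hy.
Qed.

Lemma is_derive_ht h t v :
  is_derive t 1 h v -> is_derive t 1 (fun s => ht (h s)) (ht v).
Proof.
pose f : {linear heis R n -> R} :=
  HB.pack (fun p : heis R n => ht p : R) (GRing.isLinear.Build _ _ _ _ _
    ht_is_linear).
by apply: (@is_derive_linear R _ _ f); exact: continuous_ht.
Qed.

Lemma is_derive_sumf (F dF : 'I_n -> R -> R) (t : R) :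
  (forall i, is_derive t 1 (F i) (dF i t)) ->
  is_derive t 1 (fun s => \sum_(i < n) F i s) (\sum_(i < n) dF i t).
Proof.
move=> FdF; rewrite (_ : (fun s => _) = \sum_(i < n) F i).
  exact: is_derive_sum.
by apply/funext => s; rewrite fct_sumE.
Qed.

Lemma is_derive_sqn_ldiv q h t v : is_derive t 1 h v ->
  is_derive t 1 (fun s => sqn (ldiv q (h s)))
    (2 * \sum_(i < n)
       (hx (ldiv q (h t)) i * hx v i + hy (ldiv q (h t)) i * hy v i)).
Proof.
move=> dh; rewrite mulr_sumr; apply: (@is_derive_sumf
  (fun i s => hx (ldiv q (h s)) i ^+ 2 + hy (ldiv q (h s)) i ^+ 2)
  (fun i s => 2 * (hx (ldiv q (h s)) i * hx v i + hy (ldiv q (h s)) i * hy v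
    i))).
move=> i.
have dx := is_derive_hx i dh; have dy := is_derive_hy i dh.
rewrite (_ : (fun s => _) = (fun s => (hx (h s) i - hx q i) ^+ 2
   + (hy (h s) i - hy q i) ^+ 2)); last first.
  by apply/funext => s; rewrite hx_ldiv hy_ldiv.
apply: is_derive_eq; rewrite /GRing.scale/= hx_ldiv hy_ldiv; ring.
Qed.

(** The vertical coordinate of q^-1 h(s) moves at the T-component, taken in the
    frame at q, of the velocity. *)
Lemma is_derive_ht_ldiv q h t v : is_derive t 1 h v ->
  is_derive t 1 (fun s => ht (ldiv q (h s))) (T_coord q v).
Proof.
move=> dh; rewrite -[T_coord q v]/(ht v - sympl v q).
have ds : is_derive t 1 (fun s => sympl (h s) q) (sympl v q).
  apply: (@is_derive_sumf (fun i s => hx (h s) i * hy q i - hy (h s) i * hx q i)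
    (fun i s => hx v i * hy q i - hy v i * hx q i)) => i.
  have dx := is_derive_hx i dh; have dy := is_derive_hy i dh.
  by apply: is_derive_eq; rewrite /GRing.scale/=; ring.
have dt := is_derive_ht dh.
rewrite (_ : (fun s => _) = (fun s => ht (h s) - ht q - sympl (h s) q)) //.
by apply: is_derive_eq; rewrite /GRing.scale/=; ring.
Qed.

Lemma T_coordE p v : T_coord p v = ht v - sympl v p.
Proof. by []. Qed.

Lemma symplDl p q v : sympl (p + q) v = sympl p v + sympl q v.
Proof.
rewrite /sympl -big_split; apply: eq_bigr => i _ /=.
by rewrite /hx /hy !mxE; ring.
Qed.

Lemma symplZl (a : R) p v : sympl (a *: p) v = a * sympl p v.
Proof.
rewrite /sympl mulr_sumr; apply: eq_bigr => i _ /=.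
by rewrite /hx /hy !mxE; ring.
Qed.

Lemma T_coord_is_linear p : linear (@T_coord R n p : heis R n -> R).
Proof.
move=> a u v; rewrite !T_coordE symplDl symplZl.
by rewrite {1}/ht /= /GRing.scale /= -/(ht u) -/(ht v); ring.
Qed.

Lemma horizontalP p v : horizontal p v <-> ht v = sympl v p.
Proof.
pose f : {linear heis R n -> R} := HB.pack (T_coord p : heis R n -> R)
  (GRing.isLinear.Build _ _ _ _ _ (T_coord_is_linear p)).
have fE u : f u = ht u - sympl u p by [].
have fZ c u : f (c *: u) = c * f u by exact: linearZ.
split => [[a [b ->]]|vh].
  apply/eqP; rewrite -subr_eq0 -fE raddfD !raddf_sum big1 => [|i _].
    rewrite big1 ?addr0// => i _; apply: etrans (fZ _ _) _.
    by rewrite fE -T_coordE T_coord_Y mulr0.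
  by apply: etrans (fZ _ _) _; rewrite fE -T_coordE T_coord_X mulr0.
exists (hx v), (hy v); rewrite {1}(frame_decomposition p v).
by rewrite T_coordE vh subrr scale0r addr0.
Qed.

Lemma riem_norm_horizontal p v : horizontal p v ->
  riem_norm p v ^+ 2 = sqn v.
Proof.
move=> /horizontalP vp; rewrite /riem_norm sqr_sqrtr; last first.
  by rewrite /riem !addr_ge0 ?sumr_ge0// => *; rewrite -expr2 sqr_ge0.
by rewrite /riem T_coordE vp subrr mul0r addr0 /sqn big_split.
Qed.

Lemma cvg_sumf {T : Type} (F : set_system T) {FF : Filter F} (I : finType)
    (f : I -> T -> R) (l : I -> R) :
  (forall i, f i x @[x --> F] --> l i) ->
  \sum_i f i x @[x --> F] --> \sum_i l i.
Proof. by move=> fl; apply: cvg_big => //; exact: add_continuous. Qed.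

Lemma cvg_hx {T : Type} (F : set_system T) {FF : Filter F} (f : T -> heis R n)
  p i :
  f @ F --> p -> hx (f x) i @[x --> F] --> hx p i.
Proof. by move=> fp; exact: (cvg_comp _ _ fp (@continuous_hx i p)). Qed.

Lemma cvg_hy {T : Type} (F : set_system T) {FF : Filter F} (f : T -> heis R n)
  p i :
  f @ F --> p -> hy (f x) i @[x --> F] --> hy p i.
Proof. by move=> fp; exact: (cvg_comp _ _ fp (@continuous_hy i p)). Qed.

Lemma cvg_ht {T : Type} (F : set_system T) {FF : Filter F} (f : T -> heis R n)
  p :
  f @ F --> p -> ht (f x) @[x --> F] --> ht p.
Proof. by move=> fp; exact: (cvg_comp _ _ fp (@continuous_ht p)). Qed.

Lemma cvg_sympl {T : Type} (F : set_system T) {FF : Filter F}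
    (f g : T -> heis R n) p q :
  f @ F --> p -> g @ F --> q -> sympl (f x) (g x) @[x --> F] --> sympl p q.
Proof.
move=> fp gq; apply: (@cvg_sumf T F FF 'I_n
  (fun i x => hx (f x) i * hy (g x) i - hy (f x) i * hx (g x) i)) => i.
by apply: cvgB; apply: cvgM; do ?[exact: cvg_hx|exact: cvg_hy].
Qed.

Lemma cvg_sqn {T : Type} (F : set_system T) {FF : Filter F} (f : T -> heis R
  n) p :
  f @ F --> p -> sqn (f x) @[x --> F] --> sqn p.
Proof.
move=> fp; apply: (@cvg_sumf T F FF 'I_n
  (fun i x => hx (f x) i * hx (f x) i + hy (f x) i * hy (f x) i)) => i.
by apply: cvgD; apply: cvgM; do ?[exact: cvg_hx|exact: cvg_hy].
Qed.

Lemma cvg_heis {T : Type} (F : set_system T) {FF : Filter F}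
    (f1 f2 : T -> 'rV[R]_n) (f3 : T -> R) x y t :
  f1 @ F --> x -> f2 @ F --> y -> f3 @ F --> t ->
  ((f1 s, f2 s, f3 s) : heis R n) @[s --> F] --> ((x, y, t) : heis R n).
Proof. by move=> h1 h2 h3; exact: (cvg_pair (cvg_pair h1 h2) h3). Qed.

Lemma cvg_x {T : Type} (F : set_system T) {FF : Filter F} (f : T -> heis R n)
  p :
  f @ F --> p -> (f s).1.1 @[s --> F] --> p.1.1.
Proof.
move=> fp; apply: (@cvg_comp _ _ _ f (fst \o fst) F (nbhs p)) => //.
by apply: (@cvg_comp _ _ _ fst fst (nbhs p) (nbhs p.1)); exact: cvg_fst.
Qed.

Lemma cvg_y {T : Type} (F : set_system T) {FF : Filter F} (f : T -> heis R n)
  p :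
  f @ F --> p -> (f s).1.2 @[s --> F] --> p.1.2.
Proof.
move=> fp; apply: (@cvg_comp _ _ _ f (snd \o fst) F (nbhs p)) => //.
by apply: (@cvg_comp _ _ _ fst snd (nbhs p) (nbhs p.1));
  [exact: cvg_fst|exact: cvg_snd].
Qed.

Lemma cvg_ldiv {T : Type} (F : set_system T) {FF : Filter F}
    (f g : T -> heis R n) q p :
  f @ F --> q -> g @ F --> p -> ldiv (f x) (g x) @[x --> F] --> ldiv q p.
Proof.
move=> fq gp; apply: cvg_heis.
- by apply: cvgB; exact: cvg_x.
- by apply: cvgB; exact: cvg_y.
- apply: cvgB; last exact: cvg_sympl.
  by apply: cvgB; exact: cvg_ht.
Qed.

Lemma cvg_riem_norm {T : Type} (F : set_system T) {FF : Filter F}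
    (f g : T -> heis R n) p v :
  f @ F --> p -> g @ F --> v ->
  riem_norm (f x) (g x) @[x --> F] --> riem_norm p v.
Proof.
move=> fp gv; apply: (@cvg_comp _ _ _ (fun x => riem (f x) (g x) (g x)) Num.sqrt
  _ (nbhs (riem p v v))); last exact: sqrt_continuous.
have cT : T_coord (f x) (g x) @[x --> F] --> T_coord p v.
  by apply: cvgB; [exact: cvg_ht|exact: cvg_sympl].
apply: cvgD; last exact: cvgM.
apply: cvgD.
  by apply: (@cvg_sumf T F FF 'I_n (fun i x => hx (g x) i * hx (g x) i)) => i;
    apply: cvgM; exact: cvg_hx.
by apply: (@cvg_sumf T F FF 'I_n (fun i x => hy (g x) i * hy (g x) i)) => i;
  apply: cvgM; exact: cvg_hy.
Qed.

End HeisenbergCalculus.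

(** * Calibration of horizontal curves *)

Section Calibration.
Context {R : realType} {n : nat}.
Implicit Types (p q m v w : heis R n) (g h : R -> heis R n) (t c mu l : R).

Lemma smooth_is_derive h t : smooth h -> is_derive t 1 h (derive1 h t).
Proof. by move=> sh; rewrite derive1E; apply: derivableP; exact: sh 0%N t. Qed.

Lemma smooth_continuous h : smooth h -> continuous h.
Proof.
by move=> sh t; apply/differentiable_continuous/derivable1_diffP;
  exact: sh 0%N t.
Qed.

Lemma smooth_continuous1 h : smooth h -> continuous (derive1 h).
Proof.
by move=> sh t; apply/differentiable_continuous/derivable1_diffP;
  exact: sh 1%N t.
Qed.

Definition speed g t : R := riem_norm (g t) (derive1 g t).

Lemma speed_ge0 g t : 0 <= speed g t.
Proof. exact: sqrtr_ge0. Qed.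

Lemma smooth_speed h : smooth h -> continuous (speed h).
Proof.
move=> sh t; apply: cvg_riem_norm; first exact: smooth_continuous.
exact: smooth_continuous1.
Qed.

(** For c(s) = mu cot(mu s) this solves the Hamilton-Jacobi equation of the
    sub-Riemannian metric, with initial time 0 at q. *)
Definition calibration mu c q p : R := 2 * mu * ht (ldiv q p) + c * sqn (ldiv
  q p).

(** The solutions that matter are 1 / l, when mu = 0, and mu cot(mu l). *)
Definition riccati (C : R -> R) mu (a b : R) :=
  forall l, a <= l <= b -> is_derive l 1 C (- (C l ^+ 2 + mu ^+ 2)).

(** Along the curve, the derivative of the calibration at arc length L is 2 <v,
    w> - |v| |w|^2, hence at most the speed |v|. The parameter l0 keeps C away
    from its pole at 0. *)
Lemma calibration_smooth C mu (l0 : R) q h c c' : smooth h -> c <= c' ->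
  (forall t, c <= t <= c' -> horizontal (h t) (derive1 h t)) ->
  riccati C mu l0 (l0 + \int[lebesgue_measure]_(t in `[c, c']) speed h t) ->
  calibration mu (C (l0 + \int[lebesgue_measure]_(t in `[c, c']) speed h t)) q
    (h c') <=
  calibration mu (C l0) q (h c) + \int[lebesgue_measure]_(t in `[c, c']) speed
    h t.
Proof.
move=> sh cc hh.
have [F dF <-] := continuous_antiderivative (smooth_speed sh) cc.
move=> CE.
(* L is the arc length, shifted by l0. *)
pose L t := l0 + (F t - F c).
have Fle a b : c <= a -> a <= b -> b <= c' -> F a <= F b.
  move=> ca ab bc; have dFab t : t \in `[a, b] -> is_derive t 1 F (speed h t).
    rewrite !in_itv/= => /andP[ta tb]; apply: dF.
    by rewrite in_itv/=; apply/andP; split; lra.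
  exact: (is_derive_le ab dFab (fun t _ => speed_ge0 h t)).
have CL t : c <= t <= c' -> is_derive (L t) 1 C (- (C (L t) ^+ 2 + mu ^+ 2)).
  move=> /andP[ct tc]; apply: CE; rewrite /L.
  by have := Fle c t; have := Fle t c';
    rewrite !lexx ct tc => /(_ isT isT isT) ? /(_ isT isT isT) ?; apply/andP;
      split; lra.
suff : F c - calibration mu (C (L c)) q (h c) <= F c' - calibration mu (C (L
  c')) q (h c').
  by rewrite /L subrr addr0; lra.
pose dG t := speed h t - (2 * mu * sympl (derive1 h t) (ldiv q (h t)) +
  (C (L t) * (2 * \sum_(i < n)
     (hx (ldiv q (h t)) i * hx (derive1 h t) i +
      hy (ldiv q (h t)) i * hy (derive1 h t) i)) +
   sqn (ldiv q (h t)) * (- (C (L t) ^+ 2 + mu ^+ 2) * speed h t))).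
have dGE t : t \in `[c, c'] ->
    is_derive t 1 (fun t => F t - calibration mu (C (L t)) q (h t)) (dG t).
  move=> tc; have dFt := dF t tc.
  have tc' : c <= t <= c' by move: tc; rewrite in_itv.
  have dh := smooth_is_derive t sh.
  have hv : ht (derive1 h t) = sympl (derive1 h t) (h t) by apply/horizontalP;
    exact: hh.
  have d1 := is_derive_ht_ldiv q dh.
  rewrite (_ : T_coord q _ = sympl (derive1 h t) (ldiv q (h t))) in d1;
    last first.
    by rewrite sympl_ldivr -hv.
  have d2 := is_derive_sqn_ldiv q dh.
  have dL : is_derive t 1 L (speed h t).
    have -> : speed h t = 0 + (speed h t - 0) by rewrite subr0 add0r.
    exact: (is_deriveD (is_derive_cst l0 t 1) (is_deriveB dFt (is_derive_cst
      (F c) t 1))).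
  have dCL := @is_derive1_comp _ C L t _ _ (CL t tc') dL.
  have dCL' : is_derive t 1 (fun t => C (L t)) (- (C (L t) ^+ 2 + mu ^+ 2) *
    speed h t).
    exact: dCL.
  by apply: is_derive_eq; rewrite /GRing.scale/= /dG; ring.
have dG0 t : t \in `[c, c'] -> 0 <= dG t.
  rewrite in_itv/= => tc.
  have := calibration_bound (C (L t)) mu (ldiv q (h t)) (speed_ge0 h t)
    (riem_norm_horizontal (hh t tc)).
  by rewrite subr_ge0; lra.
exact: (is_derive_le cc dGE dG0).
Qed.


(** Induction over the partition. Integrability of the speed is proved on the
    way, as the length of the curve is split into the lengths of its pieces. *)
Lemma calibration_curve (s : seq R) C mu (l0 : R) q (a b : R) g :
  itv_partition a b s ->
  (forall i, (i < size s)%N ->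
      exists2 h : R -> heis R n, smooth h &
        forall t, nth b (a :: s) i <= t <= nth b (a :: s) i.+1 ->
          g t = h t /\ horizontal (h t) (derive1 h t)) ->
  lebesgue_measure.-integrable `[a, b] (EFin \o speed g) /\
  (riccati C mu l0 (l0 + curve_length a b g) ->
   calibration mu (C (l0 + curve_length a b g)) q (g b) <=
   calibration mu (C l0) q (g a) + curve_length a b g).
Proof.
elim: s a l0 => [|x s IH] a l0 [ps /eqP sb] pieces.
  have ab : a = b by [].
  rewrite -ab /curve_length set_itv1 Rintegral_set1 !addr0; split => //.
  apply: null_set_integrable => //; last exact: lebesgue_measure_set1.
  exact: measurable_fun_set1.
move: ps => /= /andP[ax ps].
have ps' : itv_partition x b s by split => //; apply/eqP.
have xb := itv_partition_le ps'.
have [|ig Hs] := IH x (l0 + \int[lebesgue_measure]_(t in `[a, x]) speed g t)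
  ps'.
  by move=> i si; exact: (pieces i.+1).
have [h sh gh] := pieces 0%N isT; rewrite /= in gh.
have gh' t : a < t < x -> speed g t = speed h t.
  move=> /andP[at_ tx]; rewrite /speed.
  have [|-> _] := gh t; first by rewrite !ltW.
  congr riem_norm; rewrite !derive1E; apply: near_eq_derive.
  have tax : t \in `]a, x[ by rewrite in_itv/= at_ tx.
  near=> z; have : z \in `]a, x[ by near: z; exact: near_in_itvoo.
  by rewrite in_itv/= => /andP[az zx]; have [|-> _] := gh z; rewrite ?ltW.
have [iax lax] := integrable_itv_eq_oo gh'
  (continuous_compact_integrable (@segment_compact _ _ _)
     (continuous_subspaceT (smooth_speed sh))).
have [iab lE] := integrable_itv_cat (ltW ax) xb iax ig.
have {}lE : curve_length a b g =
  \int[lebesgue_measure]_(t in `[a, x]) speed g t + curve_length x b g by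
    exact: lE.
split; [exact: iab|rewrite lE addrA => CE'].
have len0 : 0 <= curve_length x b g.
  by apply: Rintegral_ge0 => t _; exact: speed_ge0.
have lax0 : 0 <= \int[lebesgue_measure]_(t in `[a, x]) speed g t.
  by apply: Rintegral_ge0 => t _; exact: speed_ge0.
apply: (le_trans (Hs _)).
  move=> l /andP[l1 l2]; apply: CE'; apply/andP; split; last exact: l2.
  by apply: le_trans l1; rewrite lerDl; exact: lax0.
rewrite addrA lerD2r.
have [|ga _] := gh a; first by rewrite lexx ltW.
have [|gx _] := gh x; first by rewrite lexx ltW.
rewrite ga gx lax; apply: calibration_smooth;
  [exact: sh|exact: ltW|by move=> t /gh[]|].
rewrite -lax => l /andP[l1 l2]; apply: CE'; apply/andP; split; first exact: l1.
by apply: (le_trans l2); rewrite lerDl; exact: len0.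
Unshelve. all: by end_near. Qed.

End Calibration.

(** * Gaveau function and lower bound of the distance *)

Section LowerBound.
Context {R : realType} {n : nat}.
Implicit Types (p q m v w : heis R n) (g h : R -> heis R n) (t c mu l phi : R).

(** The functions of (Z, t) whose supremum over |phi| < pi is the squared
    distance. *)
Definition gaveau phi m : R := 2 * phi * ht m + chi phi * sqn m.

Lemma riccati_inv (a b : R) : 0 < a -> riccati (fun l => l^-1) 0 a b.
Proof.
move=> a0 l /andP[al _]; have l0 : l != 0 by rewrite gt_eqF// (lt_le_trans a0).
apply: is_derive_eq; first exact: is_deriveV.
by rewrite /GRing.scale/= expr0n/= addr0 mulr1 exprVn.
Qed.

Lemma riccati_cot mu (a b : R) : mu != 0 -> 0 < a -> `|mu| * b < pi ->
  riccati (fun l => mu * cos (mu * l) / sin (mu * l)) mu a b.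
Proof.
move=> mu0 a0 mub l /andP[al lb].
have l0 : 0 < l by exact: lt_le_trans al.
have s0 : sin (mu * l) != 0.
  apply: sin_neq0; first by rewrite mulf_neq0// gt_eqF.
  by rewrite normrM (gtr0_norm l0) (le_lt_trans _ mub)// ler_wpM2l.
have dm : is_derive l 1 (fun l => mu * l) mu.
  by apply: is_derive_eq; rewrite /GRing.scale/= mulr1.
have ds : is_derive l 1 (fun l => sin (mu * l)) (cos (mu * l) * mu).
  exact: (@is_derive1_comp _ (@sin R) (fun l => mu * l)).
have dc : is_derive l 1 (fun l => cos (mu * l)) (- sin (mu * l) * mu).
  exact: (@is_derive1_comp _ (@cos R) (fun l => mu * l)).
have dV : is_derive l 1 (fun l => (sin (mu * l))^-1)
    (- (sin (mu * l)) ^- 2 *: (cos (mu * l) * mu)).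
  exact: is_deriveV.
apply: is_derive_eq; rewrite /GRing.scale/=.
by field.
Qed.

Lemma calibration_refl mu c q : calibration mu c q q = 0.
Proof. by rewrite /calibration ht_ldivv sqn_ldivv !mulr0 addr0. Qed.

Lemma curve_length_ge0 (a b : R) g : 0 <= curve_length a b g.
Proof. by apply: Rintegral_ge0 => t _; exact: speed_ge0. Qed.

(** The calibration starts at l0 = e and not at the pole 0; the loss disappears
    as e tends to 0. *)
Lemma gaveau_le_curve_length phi (a b : R) g : `|phi| < pi ->
  horizontal_curve a b g ->
  gaveau phi (ldiv (g a) (g b)) <= curve_length a b g ^+ 2.
Proof.
move=> phipi [s ps pieces]; set l := curve_length a b g.
have l0 : 0 <= l := curve_length_ge0 a b g.
suff H e : 0 < e -> gaveau phi (ldiv (g a) (g b)) <= l * (l + e).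
  apply/ler_addgt0Pr => e e0; have l1 : 0 < l + 1 by lra.
  apply: (le_trans (H _ (divr_gt0 e0 l1))).
  rewrite mulrDr -expr2 lerD2l mulrCA ger_pMr// ler_pdivrMr//; lra.
move=> e0; have le0 : 0 < e + l by lra.
have [p0|p0] := eqVneq phi 0.
  have [_ /(_ (@riccati_inv e _ e0))] := @calibration_curve _ _ s (fun l =>
    l^-1) 0 e (g a) a b g ps pieces.
  rewrite calibration_refl add0r -/l /calibration /gaveau p0 /chi eqxx.
  by rewrite !mulr0 !mul0r !add0r mul1r mulrC ler_pdivrMr// (addrC e).
have mu0 : phi / (e + l) != 0 by rewrite mulf_neq0// invr_eq0 gt_eqF.
have mub : `|phi / (e + l)| * (e + l) < pi.
  by rewrite normrM normfV (gtr0_norm le0) mulfVK// gt_eqF.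
have [_ /(_ (@riccati_cot _ e _ mu0 e0 mub))] := @calibration_curve _ _ s
  (fun k => phi / (e + l) * cos (phi / (e + l) * k) / sin (phi / (e + l) * k))
  (phi / (e + l)) e (g a) a b g ps pieces.
rewrite -/l calibration_refl add0r.
rewrite /calibration /gaveau /chi (negbTE p0) mulfVK ?gt_eqF//.
rewrite -(ler_pM2l le0) (addrC l) (mulrC l).
apply: le_trans; rewrite le_eqVlt; apply/orP; left; apply/eqP.
have sp := sin_neq0 p0 phipi.
by field; rewrite sp gt_eqF.
Qed.

Lemma cc_dist_le (a b : R) g : horizontal_curve a b g ->
  cc_dist (g a) (g b) <= curve_length a b g.
Proof.
move=> hg; apply: ge_inf; last by exists a, b, g.
by exists 0 => _ [a' [b' [g' [_ _ _ ->]]]]; exact: curve_length_ge0.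
Qed.

(** A curve has to exist, because the infimum of the empty set is 0. *)
Lemma le_cc_dist p q (x : R) :
  (exists a b g, [/\ horizontal_curve a b g, g a = p & g b = q]) ->
  (forall a b g, horizontal_curve a b g -> g a = p -> g b = q ->
     x <= curve_length a b g) ->
  x <= cc_dist p q.
Proof.
move=> [a [b [g [hg ga gb]]]] H; apply: lb_le_inf.
  by exists (curve_length a b g), a, b, g.
by move=> _ [a' [b' [g' [h1 h2 h3 ->]]]]; exact: H.
Qed.

End LowerBound.

(** * Trigonometric curves *)

Section TrigonometricCurves.
Context {R : realType} {V : normedModType R}.
Implicit Types (A B C D : V) (nu s : R).

(** A class of curves that is closed under derivation, which gives smoothness
    by induction. *)
Definition trig_curve A B C D nu s : V :=
  A + s *: B + sin (nu * s) *: C + cos (nu * s) *: D.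

Lemma is_derive_scalel (f : R -> R) (df s : R) A :
  is_derive s 1 f df -> is_derive s 1 (fun x => f x *: A) (df *: A).
Proof.
pose F : {linear R -> V} := HB.pack (fun x : R => x *: A)
  (GRing.isLinear.Build _ _ _ _ (fun x : R => x *: A)
    (fun a x y => etrans (scalerDl _ _ _) (congr2 +%R (esym (scalerA _ _ _))
      erefl))).
by apply: (@is_derive_linear R _ _ F); exact: scalel_continuous.
Qed.

Lemma is_derive_trig A B C D nu s :
  is_derive s 1 (trig_curve A B C D nu)
    (trig_curve B 0 (- nu *: D) (nu *: C) nu s).
Proof.
have dm : is_derive s 1 (fun x => nu * x) nu.
  by apply: is_derive_eq; rewrite /GRing.scale/= mulr1.
have ds : is_derive s 1 (fun x => sin (nu * x)) (cos (nu * s) * nu).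
  exact: (@is_derive1_comp _ (@sin R) (fun x => nu * x)).
have dc : is_derive s 1 (fun x => cos (nu * x)) (- sin (nu * s) * nu).
  exact: (@is_derive1_comp _ (@cos R) (fun x => nu * x)).
have dA := is_derive_cst A s 1.
have dB := is_derive_scalel B (is_derive_id s 1).
have dC := is_derive_scalel C ds.
have dD := is_derive_scalel D dc.
have := is_deriveD (is_deriveD (is_deriveD dA dB) dC) dD.
rewrite /trig_curve scaler0 add0r scale1r addr0 !scalerA => d.
rewrite -addrA [X in _ + X]addrC addrA mulrN -mulNr.
exact: d.
Qed.

Lemma derive1n_trig A B C D nu k : exists A' B' C' D',
  derive1n k (trig_curve A B C D nu) = trig_curve A' B' C' D' nu.
Proof.
elim: k => [|k [A' [B' [C' [D' IH]]]]]; first by exists A, B, C, D.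
exists B', 0, (- nu *: D'), (nu *: C').
rewrite derive1nS IH; apply/funext => s; rewrite derive1E.
by have [_ <-] := is_derive_trig A' B' C' D' nu s.
Qed.

End TrigonometricCurves.

(** * Lifted circular arcs *)

Section Arcs.
Context {R : realType} {n : nat}.
Implicit Types (p q m v w : heis R n) (g h : R -> heis R n) (t c mu l phi s :
  R).

Lemma smooth_trig (A B C D : heis R n) nu : smooth (trig_curve A B C D nu).
Proof.
move=> k t; have [A' [B' [C' [D' ->]]]] := derive1n_trig A B C D nu k.
by have [] := is_derive_trig A' B' C' D' nu t.
Qed.

Lemma heis_ext p q : (forall i, hx p i = hx q i) -> (forall i, hy p i = hy q
  i) ->
  ht p = ht q -> p = q.
Proof.
case: p => -[x y] t; case: q => -[x' y'] t'; rewrite /hx /hy /ht /= => hx hy ->.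
by congr (_, _, _); apply/rowP => i.
Qed.

Lemma hxD p q i : hx (p + q) i = hx p i + hx q i.
Proof. by rewrite /hx !mxE. Qed.
Lemma hxZ (a : R) p i : hx (a *: p) i = a * hx p i.
Proof. by rewrite /hx !mxE. Qed.
Lemma hyD p q i : hy (p + q) i = hy p i + hy q i.
Proof. by rewrite /hy !mxE. Qed.
Lemma hyZ (a : R) p i : hy (a *: p) i = a * hy p i.
Proof. by rewrite /hy !mxE. Qed.
Lemma htD p q : ht (p + q) = ht p + ht q.
Proof. by []. Qed.
Lemma htZ (a : R) p : ht (a *: p) = a * ht p.
Proof. by []. Qed.

Definition coordE := (hxD, hxZ, hyD, hyZ, htD, htZ).

(** The rotation J of the horizontal plane with sympl z' z = <J z, z'>. *)
Definition hrot w : heis R n := (w.1.2, - w.1.1, 0).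
(** The horizontal vector at q with the horizontal coordinates of w. *)
Definition hlift q w : heis R n := (w.1.1, w.1.2, sympl w q).
Definition vert t : heis R n := (0, 0, t).

Lemma hx_hrot w i : hx (hrot w) i = hy w i. Proof. by []. Qed.
Lemma hy_hrot w i : hy (hrot w) i = - hx w i. Proof. by rewrite /hy mxE. Qed.
Lemma hx_hlift q w i : hx (hlift q w) i = hx w i. Proof. by []. Qed.
Lemma hy_hlift q w i : hy (hlift q w) i = hy w i. Proof. by []. Qed.
Lemma ht_hlift q w : ht (hlift q w) = sympl w q. Proof. by []. Qed.
Lemma hx_vert t i : hx (vert t) i = 0. Proof. by rewrite /hx mxE. Qed.
Lemma hy_vert t i : hy (vert t) i = 0. Proof. by rewrite /hy mxE. Qed.
Lemma ht_vert t : ht (vert t) = t. Proof. by []. Qed.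

Definition liftE :=
  (hx_hrot, hy_hrot, hx_hlift, hy_hlift, ht_hlift, hx_vert, hy_vert, ht_vert).

Definition arcS mu s : R := if mu == 0 then s else sin (2 * mu * s) / (2 * mu).
Definition arcV mu s : R :=
  if mu == 0 then 0 else (1 - cos (2 * mu * s)) / (2 * mu).
Definition arcT mu s : R :=
  if mu == 0 then 0 else (2 * mu * s - sin (2 * mu * s)) / (4 * mu ^+ 2).

(** The horizontal curve that leaves q with velocity w and turns at speed 2 mu:
    its projection is the circle arc with velocity exp(2 mu s J) w, and for a
    unit vector w the coefficient [arcT] is twice the area that it sweeps. The
    coefficients satisfy arcS' = cos(2 mu s), arcV' = sin(2 mu s) and arcT' =
    arcV, for mu = 0 as well. *)
Definition harc q w mu s : heis R n :=
  q + arcS mu s *: hlift q w + arcV mu s *: hlift q (hrot w)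
    + arcT mu s *: vert (sqn w).

Lemma harc_trig q w mu : exists A B C D, harc q w mu = trig_curve A B C D (2 *
  mu).
Proof.
have [->|mu0] := eqVneq mu 0.
  exists q, (hlift q w), 0, 0; apply/funext => s.
  by rewrite /harc /trig_curve /arcS /arcV /arcT eqxx !scaler0 !scale0r !addr0.
exists (q + (2 * mu)^-1 *: hlift q (hrot w)), (vert (sqn w / (2 * mu))),
  ((2 * mu)^-1 *: hlift q w + vert (- sqn w / (4 * mu ^+ 2))),
  (- (2 * mu)^-1 *: hlift q (hrot w)).
apply/funext => s; rewrite /harc /trig_curve /arcS /arcV /arcT (negbTE mu0).
apply: heis_ext => [i|i|]; rewrite !coordE !liftE; by field.
Qed.

Lemma smooth_harc q w mu : smooth (harc q w mu).
Proof.
by have [A [B [C [D ->]]]] := harc_trig q w mu; exact: smooth_trig.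
Qed.

Definition harc_velocity q w mu s : heis R n :=
  cos (2 * mu * s) *: hlift q w + sin (2 * mu * s) *: hlift q (hrot w)
    + arcV mu s *: vert (sqn w).

Lemma derive1_harc q w mu s : derive1 (harc q w mu) s = harc_velocity q w mu s.
Proof.
have dm : is_derive s 1 (fun x => 2 * mu * x) (2 * mu).
  by apply: is_derive_eq; rewrite /GRing.scale/= mulr1.
have ds : is_derive s 1 (fun x => sin (2 * mu * x)) (cos (2 * mu * s) * (2 *
  mu)).
  exact: (@is_derive1_comp _ (@sin R) (fun x => 2 * mu * x)).
have dc : is_derive s 1 (fun x => cos (2 * mu * x)) (- sin (2 * mu * s) * (2 *
  mu)).
  exact: (@is_derive1_comp _ (@cos R) (fun x => 2 * mu * x)).
have dS : is_derive s 1 (arcS mu) (cos (2 * mu * s)).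
  rewrite /arcS; case: eqVneq => [->|mu0].
    by rewrite mulr0 mul0r cos0; exact: is_derive_id.
  by apply: is_derive_eq; rewrite /GRing.scale/=; field.
have dV : is_derive s 1 (arcV mu) (sin (2 * mu * s)).
  rewrite /arcV; case: eqVneq => [->|mu0].
    by rewrite mulr0 mul0r sin0; exact: is_derive_cst.
  by apply: is_derive_eq; rewrite /GRing.scale/=; field.
have dT : is_derive s 1 (arcT mu) (arcV mu s).
  rewrite /arcT /arcV; case: eqVneq => [_|mu0]; first exact: is_derive_cst.
  by apply: is_derive_eq; rewrite /GRing.scale/=; field.
have := is_deriveD (is_deriveD (is_deriveD (is_derive_cst q s 1)
  (is_derive_scalel (hlift q w) dS)) (is_derive_scalel (hlift q (hrot w)) dV))
  (is_derive_scalel (vert (sqn w)) dT).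
rewrite add0r => d; rewrite derive1E.
by case: d.
Qed.

Lemma sqn_harc_velocity q w mu s : sqn (harc_velocity q w mu s) = sqn w.
Proof.
apply: eq_bigr => i _; rewrite /harc_velocity !coordE !liftE.
transitivity ((cos (2 * mu * s) ^+ 2 + sin (2 * mu * s) ^+ 2) *
  (hx w i ^+ 2 + hy w i ^+ 2)); first by ring.
by rewrite cos2Dsin2 mul1r.
Qed.

Lemma horizontal_harc q w mu s : horizontal (harc q w mu s) (derive1 (harc q w
  mu) s).
Proof.
apply/horizontalP; rewrite derive1_harc /harc_velocity !coordE !liftE /sympl
  /sqn.
rewrite !mulr_sumr -!big_split; apply: eq_bigr => i _ /=.
rewrite /harc !coordE !liftE /arcV /arcS /arcT; case: eqVneq => [->|mu0].
  by rewrite !(mulr0, mul0r) cos0 sin0; ring.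
have := cos2Dsin2 (2 * mu * s); set a := cos _; set b := sin _ => ab.
apply/eqP; rewrite -subr_eq0; apply/eqP.
transitivity ((1 - (a ^+ 2 + b ^+ 2)) / (2 * mu) * (hx w i ^+ 2 + hy w i ^+ 2)).
  by field.
by rewrite ab subrr !mul0r.
Qed.

End Arcs.

(** * Geometry of the lifted arcs *)

Section ArcGeometry.
Context {R : realType} {n : nat}.
Implicit Types (p q m v w : heis R n) (g h : R -> heis R n) (t c mu l phi s :
  R).

Lemma horizontal_curve_harc q w mu (a b : R) : a <= b ->
  horizontal_curve a b (harc q w mu).
Proof.
rewrite le_eqVlt => /predU1P[->|ab]; first by exists [::].
exists [:: b]; first exact: itv_partition1.
move=> i _; exists (harc q w mu); first exact: smooth_harc.
by move=> t _; split => //; exact: horizontal_harc.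
Qed.

Lemma curve_length_harc q w mu (a b : R) : a <= b -> sqn w = 1 ->
  curve_length a b (harc q w mu) = b - a.
Proof.
move=> ab w1; rewrite /curve_length (@eq_Rintegral _ _ _ _ _ (cst 1)).
  rewrite Rintegral_cst// mul1r [X in fine X](@lebesgue_measure_itv R `[a, b])
    /= lte_fin.
  by move: ab; rewrite le_eqVlt => /predU1P[->|->//]; rewrite ltxx subrr.
move=> t _; have := riem_norm_horizontal (horizontal_harc q w mu t).
rewrite derive1_harc sqn_harc_velocity w1 => /eqP;
  rewrite sqrf_eq1 => /orP[/eqP//|/eqP E].
by have := sqrtr_ge0 (riem (harc q w mu t) (harc_velocity q w mu t)
  (harc_velocity q w mu t));
  rewrite -/(riem_norm _ _) E; lra.
Qed.

Lemma harc0 q w mu : harc q w mu 0 = q.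
Proof.
rewrite /harc /arcS /arcV /arcT !mulr0 sin0 cos0 !subrr !mul0r.
by case: ifP; rewrite !scale0r !addr0.
Qed.

Lemma sqn_ldiv_harc q w mu s s' :
  sqn (ldiv (harc q w mu s) (harc q w mu s')) =
  ((arcS mu s' - arcS mu s) ^+ 2 + (arcV mu s' - arcV mu s) ^+ 2) * sqn w.
Proof.
rewrite /sqn mulr_sumr; apply: eq_bigr => i _.
by rewrite hx_ldiv hy_ldiv /harc !coordE !liftE; ring.
Qed.

Lemma ht_ldiv_harc q w mu s s' :
  ht (ldiv (harc q w mu s) (harc q w mu s')) =
  (arcT mu s' - arcT mu s + arcS mu s' * arcV mu s - arcV mu s' * arcS mu s) *
    sqn w.
Proof.
rewrite ht_ldiv {1 2}/harc !coordE !liftE.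
transitivity ((arcS mu s' - arcS mu s) * sympl w q
  + (arcV mu s' - arcV mu s) * sympl (hrot w) q
  + (arcT mu s' - arcT mu s) * sqn w - sympl (harc q w mu s') (harc q w mu s)).
  by ring.
rewrite /sympl /sqn !mulr_sumr -!big_split -sumrB; apply: eq_bigr => i _ /=.
by rewrite /harc !coordE !liftE; ring.
Qed.

(** On the lifted arcs the lower bound of the distance is attained, at the
    half-angle mu (s' - s). *)
Lemma gaveau_harc q w mu s s' : s < s' -> `|mu| * (s' - s) < pi ->
  gaveau (mu * (s' - s)) (ldiv (harc q w mu s) (harc q w mu s')) =
  (s' - s) ^+ 2 * sqn w.
Proof.
move=> ss' mupi; have d0 : 0 < s' - s by rewrite subr_gt0.
rewrite /gaveau sqn_ldiv_harc ht_ldiv_harc /arcS /arcV /arcT /chi.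
case: (eqVneq mu 0) => [->|mu0].
  by rewrite mul0r eqxx; ring.
rewrite mulf_eq0 (negbTE mu0) gt_eqF//=.
have sn0 : sin (mu * (s' - s)) != 0.
  apply: sin_neq0; first by rewrite mulf_neq0// gt_eqF.
  by rewrite normrM (gtr0_norm d0).
have Es : 2 * mu * s' = 2 * mu * s + mu * (s' - s) *+ 2.
  by rewrite mulr2n; ring.
have CS := cos2Dsin2 (mu * (s' - s)); have ba := cos2Dsin2 (2 * mu * s).
have sE := sinD (2 * mu * s) (mu * (s' - s) *+ 2).
have cE := cosD (2 * mu * s) (mu * (s' - s) *+ 2).
move: sE cE; rewrite -Es sin_mulr2n cos_mulr2n.
move: sn0 CS ba; set S := sin (mu * _); set C := cos (mu * _).
set b := cos (2 * mu * s); set a := sin (2 * mu * s).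
set b' := cos _; set a' := sin _ => sn0 CS ba.
have -> : C ^+ 2 *+ 2 - 1 = 1 - 2 * S ^+ 2 by rewrite mulr2n; lra.
move=> sE cE.
have E1 : (2 * mu * s' - a') / (4 * mu ^+ 2) - (2 * mu * s - a) / (4 * mu ^+ 2)
   + a' / (2 * mu) * ((1 - b) / (2 * mu)) - (1 - b') / (2 * mu) * (a / (2 * mu))
   = (2 * mu * (s' - s) - 2 * C * S) / (4 * mu ^+ 2).
  transitivity ((2 * mu * (s' - s) - (b ^+ 2 + a ^+ 2) * (2 * C * S)) / (4 *
    mu ^+ 2)).
    by rewrite sE cE; field.
  by rewrite ba mul1r.
have E2 : (a' / (2 * mu) - a / (2 * mu)) ^+ 2 +
    ((1 - b') / (2 * mu) - (1 - b) / (2 * mu)) ^+ 2 = S ^+ 2 / mu ^+ 2.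
  transitivity ((b ^+ 2 + a ^+ 2) * (C ^+ 2 + S ^+ 2) * S ^+ 2 / mu ^+ 2).
    by rewrite sE cE; field.
  by rewrite ba CS !mul1r.
by rewrite E1 E2; field; rewrite mu0.
Qed.

Lemma ldiv_inj q : injective (ldiv q).
Proof.
move=> p p' E; have hxE i : hx p i = hx p' i.
  by have := congr1 (fun m => hx m i) E; rewrite !hx_ldiv => /addIr.
have hyE i : hy p i = hy p' i.
  by have := congr1 (fun m => hy m i) E; rewrite !hy_ldiv => /addIr.
apply: heis_ext => //; have := congr1 (@ht R n) E; rewrite !ht_ldiv.
have -> : sympl p q = sympl p' q by apply: eq_bigr => i _; rewrite hxE hyE.
by move=> /addIr/addIr.
Qed.

Lemma hx_ldiv_harc q w mu s i :
  hx (ldiv q (harc q w mu s)) i = arcS mu s * hx w i + arcV mu s * hy w i.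
Proof. by rewrite hx_ldiv /harc !coordE !liftE; ring. Qed.

Lemma hy_ldiv_harc q w mu s i :
  hy (ldiv q (harc q w mu s)) i = arcS mu s * hy w i - arcV mu s * hx w i.
Proof. by rewrite hy_ldiv /harc !coordE !liftE; ring. Qed.

Lemma ht_ldiv_harc0 q w mu s :
  ht (ldiv q (harc q w mu s)) = arcT mu s * sqn w.
Proof.
rewrite -{1}(harc0 q w mu) ht_ldiv_harc /arcS /arcV /arcT !mulr0 sin0 cos0
  !subrr !mul0r.
by case: ifP => _; rewrite !subr0 !mulr0 subr0 addr0.
Qed.

End ArcGeometry.

(** * The Carnot-Caratheodory distance *)

Section Distance.
Context {R : realType} {n : nat}.
Implicit Types (p q m v w : heis R n) (g h : R -> heis R n) (t c mu l phi s :
  R).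

(** At the optimal angle phi the value of the Gaveau function is (phi / sin
    phi)^2 |Z|^2, written without the division. *)
Lemma gaveau_psi phi m : sqn m != 0 -> `|phi| < pi -> psi phi = ht m / sqn m ->
  gaveau phi m = (chi phi ^+ 2 + phi ^+ 2) * sqn m.
Proof.
move=> m0 pp pE; rewrite /gaveau.
have -> : ht m = psi phi * sqn m by rewrite pE divfK.
rewrite /chi /psi; case: eqVneq => [->|p0]; first by rewrite sin0; ring.
have s0 := sin_neq0 p0 pp; have cs := cos2Dsin2 phi.
transitivity ((phi / sin phi) ^+ 2 * (cos phi ^+ 2 + sin phi ^+ 2) * sqn m).
  by rewrite cs mulr1; field.
by field.
Qed.

Lemma gaveau_psi_gt0 phi m : sqn m != 0 -> `|phi| < pi ->
  psi phi = ht m / sqn m -> 0 < gaveau phi m.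
Proof.
move=> m0 pp pE; rewrite gaveau_psi//.
rewrite mulr_gt0//; last by rewrite lt_neqAle eq_sym m0 sqn_ge0.
have [->|p0] := eqVneq phi 0.
  by rewrite /chi eqxx expr1n expr0n addr0.
by rewrite ltr_wpDl ?sqr_ge0// exprn_even_gt0.
Qed.

(** The circular arc over the chord Z that sweeps the area t / 2 has half-angle
    phi; its initial velocity is (chi(phi) Z - phi J Z) / L. *)
Lemma harc_to q p phi : sqn (ldiv q p) != 0 -> `|phi| < pi ->
  psi phi = ht (ldiv q p) / sqn (ldiv q p) ->
  exists2 w, sqn w = 1 &
    harc q w (phi / Num.sqrt (gaveau phi (ldiv q p)))
      (Num.sqrt (gaveau phi (ldiv q p))) = p.
Proof.
set m := ldiv q p => m0 pp pE; have g0 := gaveau_psi_gt0 m0 pp pE.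
set L := Num.sqrt _; have L0 : 0 < L by rewrite sqrtr_gt0.
have LE : L ^+ 2 = (chi phi ^+ 2 + phi ^+ 2) * sqn m.
  by rewrite sqr_sqrtr ?ltW// gaveau_psi.
have LN : L != 0 by rewrite gt_eqF.
pose w := L^-1 *: (chi phi *: m + (- phi) *: hrot m).
have hxw i : hx w i = (chi phi * hx m i - phi * hy m i) / L.
  by rewrite /w !coordE !liftE; ring.
have hyw i : hy w i = (chi phi * hy m i + phi * hx m i) / L.
  by rewrite /w !coordE !liftE; ring.
have w1 : sqn w = 1.
  have -> : sqn w = (chi phi ^+ 2 + phi ^+ 2) * sqn m / L ^+ 2.
    rewrite /sqn mulr_sumr mulr_suml; apply: eq_bigr => i _.
    by rewrite hxw hyw; field.
  by rewrite LE divff// -LE expf_neq0.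
exists w => //; apply: (@ldiv_inj _ _ q).
have [p0|p0] := eqVneq phi 0.
  have tm : ht m = 0.
    by apply/eqP; move: pE; rewrite p0 psi0 => /esym/eqP;
      rewrite mulf_eq0 invr_eq0 (negbTE m0) orbF.
  apply: heis_ext => [i|i|]; rewrite ?hx_ldiv_harc ?hy_ldiv_harc
    ?ht_ldiv_harc0 ?hxw ?hyw;
    rewrite /arcS /arcV /arcT p0 mul0r eqxx /chi ?eqxx ?mul0r -/m.
  - by field.
  - by field.
  - by rewrite tm.
have mu0 : phi / L != 0 by rewrite mulf_neq0 ?invr_eq0.
have s0 := sin_neq0 p0 pp.
have cs := cos2Dsin2 phi.
have chE : chi phi = phi * cos phi / sin phi by rewrite /chi (negbTE p0).
have E : 2 * (phi / L) * L = phi *+ 2 by rewrite -mulrA divfK// mulr_natl.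
have c2 : 1 - cos (phi *+ 2) = 2 * sin phi ^+ 2 by rewrite cos_mulr2n mulr2n;
  lra.
apply: heis_ext => [i|i|]; rewrite ?hx_ldiv_harc ?hy_ldiv_harc ?ht_ldiv_harc0
  ?hxw ?hyw;
    rewrite /arcS /arcV /arcT (negbTE mu0) E ?c2 sin_mulr2n -/m ?chE.
- transitivity ((cos phi ^+ 2 + sin phi ^+ 2) * hx m i);
  last by rewrite cs mul1r.
  field; rewrite ?s0 ?p0 ?LN //.
- transitivity ((cos phi ^+ 2 + sin phi ^+ 2) * hy m i);
  last by rewrite cs mul1r.
  field; rewrite ?s0 ?p0 ?LN //.
- have -> : ht m = psi phi * sqn m by rewrite pE divfK.
  rewrite w1 /psi; apply: (@mulIf _ (L ^+ 2)); first by rewrite expf_neq0.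
  transitivity (L ^+ 2 * ((phi - sin phi * cos phi) / (2 * phi ^+ 2)) * L ^+ 2).
    field; rewrite ?s0 ?p0 ?LN //.
  congr (_ * L ^+ 2).
  rewrite LE chE; transitivity ((cos phi ^+ 2 + sin phi ^+ 2) *
    ((phi - sin phi * cos phi) / (2 * sin phi ^+ 2) * sqn m)).
    field; rewrite ?s0 ?p0 ?LN //.
  by rewrite cs mul1r.
Qed.

(** For Z = 0 the curve is a full circle of length L, run in the direction that
    the sign of t prescribes; its initial direction is arbitrary. *)
Lemma harc_to_vertical q p : (0 < n)%N -> sqn (ldiv q p) = 0 ->
  exists w mu, sqn w = 1 /\
    harc q w mu (Num.sqrt (2 * pi * `|ht (ldiv q p)|)) = p.
Proof.
set m := ldiv q p => n0 m0; have pi0 := pi_gt0 R.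
have [w w1] : exists w, sqn w = 1.
  exists (X_field (Ordinal n0) 0);
    rewrite /sqn (bigD1 (Ordinal n0))//= big1 => [|i ni].
    by rewrite /hx /hy /= !mxE !eqxx expr1n expr0n !addr0.
  by rewrite /hx /hy /= !mxE (negbTE ni) andbF expr0n addr0.
set L := Num.sqrt _; have L0 : 0 <= L := sqrtr_ge0 _.
have LE : L ^+ 2 = 2 * pi * `|ht m| by rewrite sqr_sqrtr// !mulr_ge0// ltW.
have zm := sqn_eq0 m0.
exists w; have [t0|t0] := eqVneq (ht m) 0.
  exists 0; split => //; have -> : L = 0 by rewrite /L t0 normr0 mulr0 sqrtr0.
  rewrite harc0; apply: (@ldiv_inj _ _ q).
  apply: heis_ext => [i|i|].
  - by rewrite -/m (zm i).1 hx_ldiv subrr.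
  - by rewrite -/m (zm i).2 hy_ldiv subrr.
  - by rewrite -/m t0 -(harc0 q w 0) ht_ldiv_harc /arcT eqxx; ring.
have Lp : 0 < L by rewrite sqrtr_gt0 mulr_gt0 ?mulr_gt0// normr_gt0.
have LN : L != 0 by rewrite gt_eqF.
(* The orientation of the circle. *)
pose e : R := if 0 < ht m then 1 else -1.
have et : ht m = e * `|ht m|.
  rewrite /e; case: ltP => [/gtr0_norm->|/ler0_norm->]; ring.
have e2 : e ^+ 2 = 1 by rewrite /e; case: ifP; rewrite ?sqrrN expr1n.
exists (e * pi / L); split => //; apply: (@ldiv_inj _ _ q).
have e0 : e != 0 by rewrite /e; case: ifP; rewrite ?oppr_eq0 oner_eq0.
have mu0 : e * pi / L != 0 by rewrite !mulf_neq0 ?invr_eq0// gt_eqF.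
have E : 2 * (e * pi / L) * L = e * (pi *+ 2) by rewrite -mulrA divfK//
  mulr2n; ring.
have sE : sin (e * (pi *+ 2)) = 0.
  by rewrite /e; case: ifP => _; rewrite ?mulN1r ?mul1r ?sinN sin2pi ?oppr0.
have cE : cos (e * (pi *+ 2)) = 1.
  by rewrite /e; case: ifP => _; rewrite ?mulN1r ?mul1r ?cosN cos2pi.
apply: heis_ext => [i|i|]; rewrite ?hx_ldiv_harc ?hy_ldiv_harc ?ht_ldiv_harc0
  -/m;
  rewrite /arcS /arcV /arcT (negbTE mu0) E sE ?cE ?subrr ?mul0r.
- by rewrite (zm i).1 addr0.
- by rewrite (zm i).2 subr0.
- rewrite w1 mulr1 subr0 et.
  have pn : (pi : R) != 0 by rewrite gt_eqF.
  have -> : `|ht m| = L ^+ 2 / (2 * pi).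
    by rewrite LE mulrAC divff ?mul1r// mulf_neq0.
  rewrite mulr2n -[LHS]mulr1 -e2; move: pn; move: (@pi R) => P pn.
  by field; rewrite ?pn ?e0 ?LN.
Qed.

Lemma horizontal_curve_ex q p : (0 < n)%N ->
  exists a b g, [/\ horizontal_curve a b g, g a = q & g b = p].
Proof.
move=> n0; have [m0|m0] := eqVneq (sqn (ldiv q p)) 0.
  have [w [mu [_ E]]] := harc_to_vertical n0 m0.
  refine (ex_intro _ 0 (ex_intro _ _ (ex_intro _ _ (And3 _ (harc0 _ _ _) E)))).
  by apply: horizontal_curve_harc; exact: sqrtr_ge0.
have [phi pp pE] := psi_surj (ht (ldiv q p) / sqn (ldiv q p)).
have [w _ E] := harc_to m0 pp pE.
refine (ex_intro _ 0 (ex_intro _ _ (ex_intro _ _ (And3 _ (harc0 _ _ _) E)))).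
by apply: horizontal_curve_harc; exact: sqrtr_ge0.
Qed.

Lemma cc_dist_ge0 q p : (0 < n)%N -> 0 <= cc_dist q p.
Proof.
move=> n0; apply: le_cc_dist; first exact: horizontal_curve_ex.
by move=> *; exact: curve_length_ge0.
Qed.

Lemma gaveau_le_cc_dist phi q p : (0 < n)%N -> `|phi| < pi ->
  gaveau phi (ldiv q p) <= cc_dist q p ^+ 2.
Proof.
move=> n0 pp; have : Num.sqrt (gaveau phi (ldiv q p)) <= cc_dist q p.
  apply: le_cc_dist; first exact: horizontal_curve_ex.
  move=> a b g hg <- <-; rewrite -(ger0_norm (curve_length_ge0 a b g))
    -sqrtr_sqr.
  by rewrite ler_wsqrtr// gaveau_le_curve_length.
have [g0|g0] := leP 0 (gaveau phi (ldiv q p)).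
  by move=> H; rewrite -(sqr_sqrtr g0) ler_sqr ?nnegrE ?sqrtr_ge0// cc_dist_ge0.
by move=> _; rewrite (le_trans (ltW g0))// sqr_ge0.
Qed.

Lemma cc_dist_le_harc q w mu s s' : s <= s' -> sqn w = 1 ->
  cc_dist (harc q w mu s) (harc q w mu s') <= s' - s.
Proof.
move=> ss w1; rewrite -(curve_length_harc q mu ss w1).
by apply: cc_dist_le; exact: horizontal_curve_harc.
Qed.

Lemma cc_dist_sqr phi q p : (0 < n)%N -> sqn (ldiv q p) != 0 -> `|phi| < pi ->
  psi phi = ht (ldiv q p) / sqn (ldiv q p) ->
  cc_dist q p ^+ 2 = gaveau phi (ldiv q p).
Proof.
move=> n0 m0 pp pE; have g0 := gaveau_psi_gt0 m0 pp pE.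
apply/eqP; rewrite eq_le gaveau_le_cc_dist// andbT.
have [w w1 E] := harc_to m0 pp pE.
have := cc_dist_le_harc q (phi / Num.sqrt (gaveau phi (ldiv q p)))
  (sqrtr_ge0 (gaveau phi (ldiv q p))) w1.
rewrite harc0 E subr0 => H.
by rewrite -[leRHS](sqr_sqrtr (ltW g0)) ler_sqr ?nnegrE ?sqrtr_ge0//
  cc_dist_ge0.
Qed.

(** The supremum over phi is not attained: the lower bounds 2 phi |t| tend to 2
    pi |t| as phi tends to pi. *)
Lemma cc_dist_sqr_vertical q p : (0 < n)%N -> sqn (ldiv q p) = 0 ->
  cc_dist q p ^+ 2 = 2 * pi * `|ht (ldiv q p)|.
Proof.
move=> n0 m0; have pi0 := pi_gt0 R; apply/eqP; rewrite eq_le; apply/andP; split.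
  have [w [mu [w1 E]]] := harc_to_vertical n0 m0.
  have := cc_dist_le_harc q mu (sqrtr_ge0 (2 * pi * `|ht (ldiv q p)|)) w1.
  rewrite harc0 E subr0 => H; rewrite -[leRHS]sqr_sqrtr.
    by rewrite ler_sqr ?nnegrE ?sqrtr_ge0// cc_dist_ge0.
  by rewrite !mulr_ge0// ltW.
have H e : 0 <= e -> e < pi -> 2 * e * `|ht (ldiv q p)| <= cc_dist q p ^+ 2.
  move=> e0 ep; have [t0|t0] := leP 0 (ht (ldiv q p)).
    have := @gaveau_le_cc_dist e q p n0; rewrite /gaveau m0 mulr0 addr0.
    by rewrite !ger0_norm//; apply.
  have := @gaveau_le_cc_dist (- e) q p n0; rewrite /gaveau m0 mulr0 addr0.
  rewrite normrN ger0_norm// ltr0_norm// => /(_ ep).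
  by rewrite mulrN mulNr mulrN.
rewrite leNgt; apply/negP => lt.
have tp : 0 < `|ht (ldiv q p)|.
  rewrite normr_gt0; apply: contraTneq lt => ->.
  by rewrite normr0 mulr0 -leNgt sqr_ge0.
pose x := cc_dist q p ^+ 2 / (2 * `|ht (ldiv q p)|).
have x0 : 0 <= x by rewrite divr_ge0 ?sqr_ge0// mulr_ge0.
have xp : x < pi by rewrite ltr_pdivrMr ?mulr_gt0// mulrCA mulrA.
have := H ((x + pi) / 2) _ _;
  rewrite -ler_pdivlMr// => /(_ ltac:(lra) ltac:(lra)).
have -> : cc_dist q p ^+ 2 / `|ht (ldiv q p)| = 2 * x.
  by rewrite /x; field; rewrite gt_eqF.
lra.
Qed.

(** q^-1 p and p^-1 q are opposite, and the Gaveau function is invariant under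
    (phi, m) -> (- phi, - m). *)
Lemma cc_distC q p : (0 < n)%N -> cc_dist q p = cc_dist p q.
Proof.
move=> n0; apply/eqP; rewrite -(@eqrXn2 _ 2)// ?cc_dist_ge0//.
have [m0|m0] := eqVneq (sqn (ldiv q p)) 0.
  rewrite !cc_dist_sqr_vertical//; last by rewrite sqn_ldivC.
  by rewrite ht_ldivC normrN.
have H (a b : heis R n) : sqn (ldiv a b) != 0 -> cc_dist a b ^+ 2 <= cc_dist b
  a ^+ 2.
  move=> ab0; have [phi pp pE] := psi_surj (ht (ldiv a b) / sqn (ldiv a b)).
  rewrite (cc_dist_sqr n0 ab0 pp pE) /gaveau sqn_ldivC ht_ldivC mulrN -mulNr
    -mulrN -(chiN phi).
  by apply: gaveau_le_cc_dist; rewrite // normrN.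
by rewrite eq_le !H// sqn_ldivC.
Qed.

(** The lower bound at phi = 0. *)
Lemma sqn_le_cc_dist q p : (0 < n)%N -> sqn (ldiv q p) <= cc_dist q p ^+ 2.
Proof.
move=> n0; have := @gaveau_le_cc_dist 0 q p n0.
by rewrite /gaveau normr0 pi_gt0 mulr0 mul0r add0r /chi eqxx mul1r; apply.
Qed.

(** The lower bound at phi = +- pi / 2, where [chi] vanishes. *)
Lemma norm_ht_le_cc_dist q p : (0 < n)%N ->
  pi * `|ht (ldiv q p)| <= cc_dist q p ^+ 2.
Proof.
move=> n0; have pi0 := pi_gt0 R.
have ch : chi (pi / 2) = 0 :> R.
  by rewrite /chi cos_pihalf mulr0 mul0r gt_eqF// divr_gt0.
have ab : `|pi / 2| < pi :> R by rewrite ger0_norm; lra.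
have [t0|t0] := leP 0 (ht (ldiv q p)).
  have := gaveau_le_cc_dist q p n0 ab; rewrite /gaveau ch mul0r addr0.
  by rewrite ger0_norm// (mulrC 2) divfK.
have := @gaveau_le_cc_dist (- (pi / 2)) q p n0; rewrite normrN => /(_ ab).
rewrite /gaveau chiN ch mul0r addr0 ltr0_norm//.
by rewrite mulrN mulNr mulrN (mulrC 2) divfK.
Qed.

(** At any angle, phi <= pi and chi(phi) <= 1. *)
Lemma cc_dist_sqr_le q p : (0 < n)%N ->
  cc_dist q p ^+ 2 <= 2 * pi * `|ht (ldiv q p)| + sqn (ldiv q p).
Proof.
move=> n0; have [m0|m0] := eqVneq (sqn (ldiv q p)) 0.
  by rewrite cc_dist_sqr_vertical// m0 addr0.
have [phi pp pE] := psi_surj (ht (ldiv q p) / sqn (ldiv q p)).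
rewrite (cc_dist_sqr n0 m0 pp pE) /gaveau lerD//.
  rewrite (le_trans (ler_norm _))// !normrM (@ger0_norm _ 2)//.
  by rewrite ler_wpM2r// ler_wpM2l// ltW.
by rewrite ler_piMl ?sqn_ge0 ?chi_le1.
Qed.

(** Every sub-arc of the optimal lifted arc is optimal, since its half-angle is
    smaller than pi. *)
Lemma minimizing_geodesic_ex q p : (0 < n)%N -> sqn (ldiv q p) != 0 ->
  exists g, minimizing_geodesic q p g.
Proof.
move=> n0 m0; have [phi pp pE] := psi_surj (ht (ldiv q p) / sqn (ldiv q p)).
have [w w1 E] := harc_to m0 pp pE.
set L := Num.sqrt _ in E; have L0 : 0 < L by rewrite sqrtr_gt0 gaveau_psi_gt0.
exists (harc q w (phi / L)), L; first exact: ltW.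
split => //; first exact: harc0.
have H s s' : 0 <= s -> s < s' -> s' <= L ->
    cc_dist (harc q w (phi / L) s) (harc q w (phi / L) s') = s' - s.
  move=> s0 ss' sL; apply/eqP; rewrite eq_le cc_dist_le_harc ?(ltW ss')//=.
  have mp : `|phi / L| * (s' - s) < pi.
    rewrite normrM normfV (gtr0_norm L0) (le_lt_trans _ pp)// mulrAC
      ler_pdivrMr//.
    by rewrite ler_wpM2l//; lra.
  have mp' : `|phi / L * (s' - s)| < pi by rewrite normrM (@gtr0_norm _ (s' -
    s)) ?subr_gt0.
  have := gaveau_le_cc_dist (harc q w (phi / L) s) (harc q w (phi / L) s') n0
    mp'.
  rewrite gaveau_harc// w1 mulr1 ler_sqr ?nnegrE ?cc_dist_ge0 ?subr_ge0 ?(ltW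
    ss')//.
move=> s s' /andP[s0 sL] /andP[s0' sL']; have [ss|ss|<-] := ltgtP s s'.
- by rewrite H// ltr0_norm ?opprB ?subr_lt0.
- by rewrite cc_distC// H// gtr0_norm ?subr_gt0.
- rewrite subrr normr0; apply/eqP; rewrite eq_le cc_dist_ge0// andbT.
  by have := cc_dist_le_harc q (phi / L) (lexx s) w1; rewrite subrr.
Qed.

End Distance.

(** * Addition formula for the cotangent *)

Section CotangentAddition.
Context {R : realType}.
Implicit Types (x mu s : R).

Lemma divr_sin_gt0 x : x != 0 -> `|x| < pi -> 0 < x / sin x.
Proof.
move=> x0; rewrite ltr_norml => /andP[x1 x2]; have [xp|xn|/eqP] := ltgtP 0 x.
- by rewrite divr_gt0// sin_gt0_pi// xp.
- rewrite -[x / _]mulrNN -invrN -sinN divr_gt0 ?oppr_gt0// sin_gt0_pi//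
  oppr_gt0 xn; lra.
- by rewrite eq_sym (negbTE x0).
Qed.

(** The formula cot(x + y) (cot x + cot y) = cot x cot y - 1, scaled so that it
    still holds for mu = 0. The sign comes from cot x + cot y = sin(x + y) /
    (sin x sin y) and x / sin x > 0. *)
Lemma chi_add mu s s' : 0 < s -> 0 < s' -> `|mu| * (s + s') < pi ->
  [/\ 0 < chi (mu * s) / s + chi (mu * s') / s' &
      chi (mu * (s + s')) / (s + s') *
        (chi (mu * s) / s + chi (mu * s') / s') =
      chi (mu * s) / s * (chi (mu * s') / s') - mu ^+ 2].
Proof.
move=> s0 s0' mp; have ss0 : 0 < s + s' by rewrite addr_gt0.
have [sn sn' ssn] : [/\ s != 0, s' != 0 & s + s' != 0] by rewrite !gt_eqF.
have [->|mu0] := eqVneq mu 0.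
  rewrite !mul0r /chi eqxx; split; first by rewrite addr_gt0// divr_gt0.
  by field; rewrite ?sn ?sn' ?ssn.
have bd (r : R) : 0 < r -> r <= s + s' -> `|mu * r| < pi.
  move=> r0 rs; rewrite normrM (gtr0_norm r0) (le_lt_trans _ mp)//.
  by rewrite ler_wpM2l.
have nz r : 0 < r -> mu * r != 0 by move=> r0; rewrite mulf_neq0// gt_eqF.
have b1 := bd s s0 ltac:(lra); have b2 := bd s' s0' ltac:(lra).
have b3 := bd _ ss0 (lexx _).
have n1 := sin_neq0 (nz _ s0) b1; have n2 := sin_neq0 (nz _ s0') b2.
have n3 := sin_neq0 (nz _ ss0) b3.
have g1 := divr_sin_gt0 (nz _ s0) b1; have g2 := divr_sin_gt0 (nz _ s0') b2.
have g3 := divr_sin_gt0 (nz _ ss0) b3.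
rewrite /chi (negbTE (nz _ s0)) (negbTE (nz _ s0')) (negbTE (nz _ ss0)).
have E3 : sin (mu * (s + s')) = sin (mu * s) * cos (mu * s') + cos (mu * s) *
  sin (mu * s').
  by rewrite mulrDr sinD.
have C3 : cos (mu * (s + s')) = cos (mu * s) * cos (mu * s') - sin (mu * s) *
  sin (mu * s').
  by rewrite mulrDr cosD.
have cE : mu * s * cos (mu * s) / sin (mu * s) / s +
    mu * s' * cos (mu * s') / sin (mu * s') / s' =
    mu * sin (mu * (s + s')) / (sin (mu * s) * sin (mu * s')).
  by rewrite E3; field; rewrite ?sn ?sn' ?n1 ?n2.
rewrite cE; split.
  have -> : mu * sin (mu * (s + s')) / (sin (mu * s) * sin (mu * s')) =
    (mu * s / sin (mu * s)) * (mu * s' / sin (mu * s')) /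
    (mu * (s + s') / sin (mu * (s + s'))) * ((s + s') / (s * s')).
    by field; rewrite ?mu0 ?sn ?sn' ?ssn ?n1 ?n2 ?n3.
  apply: mulr_gt0; last by rewrite divr_gt0// mulr_gt0.
  by rewrite divr_gt0// mulr_gt0.
by rewrite C3; field; rewrite ?sn ?sn' ?ssn ?n1 ?n2 ?n3.
Qed.

End CotangentAddition.

(** * Initial vectors of minimizing geodesics *)

Section InitialTangent.
Context {R : realType} {n : nat}.
Implicit Types (p q m v w : heis R n) (g h : R -> heis R n) (t c mu l phi s :
  R).

(** The angle at which the Gaveau function of a non-vertical m is maximal. *)
Definition angle m : R :=
  get [set phi | `|phi| < pi /\ psi phi = ht m / sqn m].

Lemma angleP m : `|angle m| < pi /\ psi (angle m) = ht m / sqn m.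
Proof.
have [phi pp pE] := psi_surj (ht m / sqn m).
exact: (@getI _ [set phi | `|phi| < pi /\ psi phi = ht m / sqn m] phi).
Qed.

(** The initial velocity at q of the optimal lifted arc from q to p, when q^-1
    p is not vertical. *)
Definition init_dir q p : heis R n :=
  let m := ldiv q p in
  hlift q ((cc_dist q p)^-1 *: (chi (angle m) *: m - angle m *: hrot m)).

(** [geodesic_rigidity] at g(s), with c = chi(mu s) / s and c' = chi(mu (L -
    s)) / (L - s). The equations are divided by s so that both sides have a
    limit at 0. *)
Lemma geodesic_point q p g L s : (0 < n)%N -> sqn (ldiv q p) != 0 ->
  g 0 = q -> g L = p ->
  (forall s s', 0 <= s <= L -> 0 <= s' <= L -> cc_dist (g s) (g s') = `|s -
    s'|) ->
  0 < s < L ->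
  let phi := angle (ldiv q p) in
  let a := chi (phi / L * (L - s)) / (L - s) in
  let b := chi (phi / L * s) + s * a in
  forall i,
   s^-1 * (hx (g s) i - hx q i) =
     b^-1 * (a * hx (ldiv q p) i - phi / L * hy (ldiv q p) i) /\
   s^-1 * (hy (g s) i - hy q i) =
     b^-1 * (a * hy (ldiv q p) i + phi / L * hx (ldiv q p) i).
Proof.
move=> n0 m0 g0 gL dg /andP[s0 sL] phi a b i.
have L0 : 0 < L by exact: lt_trans sL.
have [pp pE] := angleP (ldiv q p); rewrite -/phi in pp pE.
have d1 : cc_dist q (g s) = s.
  by rewrite -g0 dg ?lexx ?ltW//= ?sub0r ?normrN ?gtr0_norm// ltW.
have d2 : cc_dist (g s) p = L - s.
  by rewrite -gL dg ?lexx ?(ltW L0) ?(ltW s0) ?(ltW sL)//= distrC gtr0_norm//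
    subr_gt0.
have d3 : cc_dist q p = L.
  by rewrite -g0 -gL dg ?lexx ?(ltW L0)//= sub0r normrN gtr0_norm.
have Ls0 : 0 < L - s by rewrite subr_gt0.
have mL : `|phi / L| * L = `|phi|.
  by rewrite normrM normfV (gtr0_norm L0) divfK// gt_eqF.
have mp : `|phi / L| * (s + (L - s)) < pi by rewrite addrC subrK mL.
have [cc0 CE] := chi_add s0 Ls0 mp; rewrite addrC subrK in CE.
have bd (r : R) : 0 < r -> r <= L -> `|phi / L * r| < pi.
  move=> r0 rL; rewrite normrM (gtr0_norm r0) (le_lt_trans _ pp)// -mL.
  by rewrite ler_wpM2l.
have K (r : R) (x y : heis R n) : 0 < r -> r <= L -> cc_dist x y = r ->
    2 * (phi / L) * ht (ldiv x y) + chi (phi / L * r) / r * sqn (ldiv x y) <= r.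
  move=> r0 rL dr; have := gaveau_le_cc_dist x y n0 (bd r r0 rL).
  rewrite dr /gaveau expr2 => H; rewrite -(ler_pM2l r0).
  apply: le_trans H; rewrite le_eqVlt; apply/orP; left; apply/eqP.
  by field; rewrite ?gt_eqF.
have hT : 2 * (phi / L) * ht (ldiv q p) + chi phi / L * sqn (ldiv q p) = s +
  (L - s).
  have := cc_dist_sqr n0 m0 pp pE; rewrite d3 /gaveau => H.
  have -> : s + (L - s) = L by ring.
  apply: (@mulIf _ L); first by rewrite gt_eqF.
  by rewrite -expr2 H; field; rewrite gt_eqF.
have CE' : chi phi / L * (chi (phi / L * s) / s + a) =
    chi (phi / L * s) / s * a - (phi / L) ^+ 2.
  by rewrite -CE divfK// gt_eqF.
have [Ex Ey] := geodesic_rigidity cc0 CE' (K s q (g s) s0 (ltW sL) d1)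
  (K (L - s) (g s) p Ls0 ltac:(lra) d2) hT i.
rewrite !hx_ldiv !hy_ldiv.
have bE : b = s * (chi (phi / L * s) / s + a) by rewrite /b; field;
  rewrite gt_eqF.
have b0 : b != 0 by rewrite bE mulf_neq0 ?gt_eqF.
have sn : s != 0 by rewrite gt_eqF.
have cn : chi (phi / L * s) / s + a != 0 by rewrite gt_eqF.
have H (x y : R) : (chi (phi / L * s) / s + a) * x = y -> s^-1 * x = b^-1 * y.
  by move=> <-; rewrite bE invfM -[RHS]mulrA mulKf.
by split; apply: H.
Qed.

Lemma sympl_sub p q v : sympl (p - q) v = sympl p v - sympl q v.
Proof.
rewrite /sympl -sumrB; apply: eq_bigr => i _.
by rewrite /hx /hy !mxE; ring.
Qed.

(** The horizontal part of the difference quotient converges by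
    [geodesic_point]. Its vertical part, read at q, is at most s / pi in
    absolute value, because pi |t| <= d^2, so the limit is horizontal. *)
Lemma initial_tangentE q p g : (0 < n)%N -> sqn (ldiv q p) != 0 ->
  minimizing_geodesic q p g -> initial_tangent g = (q, init_dir q p).
Proof.
move=> n0 m0 [L L0 [g0 gL dg]]; rewrite /initial_tangent g0; congr (_, _).
set m := ldiv q p in m0 *; set phi := angle m.
have [pp _] := angleP m; rewrite -/phi in pp.
have dL : cc_dist q p = L.
  by rewrite -g0 -gL dg ?lexx ?L0//= sub0r normrN ger0_norm.
have {}L0 : 0 < L.
  rewrite lt_neqAle L0 andbT eq_sym;
    apply: contraTneq (sqn_le_cc_dist q p n0) => LE.
  by rewrite dL LE expr0n/= -ltNge lt_neqAle eq_sym m0 sqn_ge0.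
have LN : L != 0 by rewrite gt_eqF.
(* The coefficients of [geodesic_point], with limits chi phi / L and 1. *)
pose a s := chi (phi / L * (L - s)) / (L - s).
pose b s := chi (phi / L * s) + s * a s.
have near0 : \forall s \near (0 : R)^'+, 0 < s < L.
  near=> s; apply/andP; split.
    by near: s; exact: nbhs_right_gt.
  by near: s; exact: nbhs_right_lt.
have cid : (s : R) @[s --> (0 : R)^'+] --> (0 : R).
  by apply: cvg_at_right_filter; exact: cvg_id.
have ca : a s @[s --> (0 : R)^'+] --> chi phi / L.
  have cLs : L - s @[s --> (0 : R)^'+] --> L.
    by rewrite -[X in _ --> X]subr0; apply: cvgB => //; exact: cvg_cst.
  have -> : chi phi / L = chi (phi / L * L) / L by rewrite divfK.
  apply: cvgM; last exact: cvgV.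
  apply: (@cvg_comp _ _ _ (fun s => phi / L * (L - s)) chi _ (nbhs (phi / L *
    L))).
    by apply: cvgM => //; exact: cvg_cst.
  by apply: continuous_chi; rewrite divfK.
have cb : b s @[s --> (0 : R)^'+] --> (1 : R).
  have -> : (1 : R) = chi (phi / L * 0) + 0 * (chi phi / L).
    by rewrite mulr0 mul0r addr0 /chi eqxx.
  apply: cvgD; last exact: cvgM.
  apply: (@cvg_comp _ _ _ (fun s => phi / L * s) chi _ (nbhs (phi / L * 0))).
    by apply: cvgM => //; exact: cvg_cst.
  by apply: continuous_chi; rewrite mulr0 normr0 pi_gt0.
have cbV : (b s)^-1 @[s --> (0 : R)^'+] --> (1 : R).
  by rewrite -[X in _ --> X]invr1; apply: cvgV => //; exact: oner_neq0.
pose D s := s^-1 *: (g s - q).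
pose v := L^-1 *: (chi phi *: m - phi *: hrot m).
pose u s := (b s)^-1 *: (a s *: m - (phi / L) *: hrot m).
have vE : v = 1 *: ((chi phi / L) *: m - (phi / L) *: hrot m).
  by rewrite scale1r /v scalerBr !scalerA !(mulrC L^-1).
have cu : u s @[s --> (0 : R)^'+] --> v.
  rewrite vE; apply: cvgZ => //; apply: cvgB; last exact: cvg_cst.
  by apply: cvgZ => //; exact: cvg_cst.
have uE s i : hx (u s) i = (b s)^-1 * (a s * hx m i - phi / L * hy m i) /\
    hy (u s) i = (b s)^-1 * (a s * hy m i + phi / L * hx m i).
  by rewrite /u -scaleNr !coordE !liftE mulNr mulrNN.
have EX : \forall s \near (0 : R)^'+, (u s).1.1 = (D s).1.1.
  near=> s; have sL : 0 < s < L by near: s.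
  apply/rowP => i.
  have [E _] := @geodesic_point q p g L s n0 m0 g0 gL dg sL i.
  transitivity (hx (u s) i) => //; rewrite (uE s i).1 -E.
  by rewrite /D /hx /= !mxE.
have EY : \forall s \near (0 : R)^'+, (u s).1.2 = (D s).1.2.
  near=> s; have sL : 0 < s < L by near: s.
  apply/rowP => i.
  have [_ E] := @geodesic_point q p g L s n0 m0 g0 gL dg sL i.
  transitivity (hy (u s) i) => //; rewrite (uE s i).2 -E.
  by rewrite /D /hy /= !mxE.
have cX : (D s).1.1 @[s --> (0 : R)^'+] --> v.1.1.
  by apply: cvg_trans; [exact: (near_eq_cvg EX)|exact: cvg_x].
have cY : (D s).1.2 @[s --> (0 : R)^'+] --> v.1.2.
  by apply: cvg_trans; [exact: (near_eq_cvg EY)|exact: cvg_y].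
have cT0 : s^-1 * ht (ldiv q (g s)) @[s --> (0 : R)^'+] --> (0 : R).
  have bnd : \forall s \near (0 : R)^'+,
      - (s / pi) <= s^-1 * ht (ldiv q (g s)) <= s / pi.
    near=> s; have /andP[s0 sL] : 0 < s < L by near: s.
    have ds : cc_dist q (g s) = s.
      by rewrite -g0 dg ?lexx ?(ltW L0) ?(ltW s0) ?(ltW sL)//= sub0r normrN
        gtr0_norm.
    rewrite -ler_norml normrM gtr0_norm ?invr_gt0// ler_pdivrMl// mulrA -expr2.
    rewrite ler_pdivlMr ?pi_gt0// mulrC.
    have := norm_ht_le_cc_dist q (g s) n0; rewrite ds.
    exact.
  have c0 : s / pi @[s --> (0 : R)^'+] --> (0 : R).
    by rewrite -[X in _ --> X](mul0r pi^-1); apply: cvgM => //; exact: cvg_cst.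
  by apply: (squeeze_cvgr bnd) => //; rewrite -[X in _ --> X]oppr0; exact: cvgN.
have cS : sympl (D s) q @[s --> (0 : R)^'+] --> sympl v q.
  have c0 : (fun=> 0 : R) @ (0 : R)^'+ --> (0 : R) by exact: cvg_cst.
  have cXY : (((D s).1.1, (D s).1.2, 0 : R) : heis R n) @[s --> (0 : R)^'+] -->
    ((v.1.1, v.1.2, 0 : R) : heis R n) by exact: cvg_heis.
  have : sympl (((D s).1.1, (D s).1.2, 0 : R) : heis R n) q @[s --> (0 :
    R)^'+] -->
    sympl ((v.1.1, v.1.2, 0 : R) : heis R n) q.
    exact: (@cvg_sympl R n R _ _ (fun s => ((D s).1.1, (D s).1.2, 0 : R))
      (fun=> q)
      (v.1.1, v.1.2, 0 : R) q cXY (cvg_cst _)).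
  have cq : (fun=> q) @ (0 : R)^'+ --> q by exact: cvg_cst.
  exact.
have cT : ht (D s) @[s --> (0 : R)^'+] --> sympl v q.
  have -> : (fun s => ht (D s)) =
      (fun s => s^-1 * ht (ldiv q (g s)) + sympl (D s) q).
    apply/funext => s; rewrite symplZl sympl_sub -mulrDr ht_ldiv.
    rewrite htZ sympl_diag.
    by congr (_ * _); rewrite /ht /=; ring.
  by rewrite -[X in _ --> X]add0r; apply: cvgD.
have cD : D s @[s --> (0 : R)^'+] --> init_dir q p.
  have : (((D s).1.1, (D s).1.2, ht (D s)) : heis R n) @[s --> (0 : R)^'+] -->
    ((v.1.1, v.1.2, sympl v q) : heis R n) by exact: cvg_heis.
  rewrite (_ : (fun s => ((D s).1.1, (D s).1.2, ht (D s)) : heis R n) = D).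
    by rewrite /init_dir dL.
  by apply/funext => s; case: (D s) => -[].
exact: (cvg_lim (@norm_hausdorff _ _) cD).
Unshelve. all: by end_near. Qed.

End InitialTangent.

(** * Continuous dependence on the end points *)

Section Continuity.
Context {R : realType} {n : nat}.
Implicit Types (p q m v w : heis R n) (phi : R).

(** The inverse of a strictly increasing function is continuous: the angle is
    trapped between x1 and x2 as soon as t / |Z|^2 is between psi(x1) and
    psi(x2). *)
Lemma cvg_angle m : sqn m != 0 -> angle x @[x --> m] --> angle m.
Proof.
move=> m0; have [pp pE] := angleP m; set phi := angle m in pp pE *.
have cr : ht x / sqn x @[x --> m] --> ht m / sqn m.
  have cid : (x : heis R n) @[x --> m] --> m by exact: cvg_id.
  by apply: cvgM; [exact: cvg_ht|apply: cvgV => //; exact: cvg_sqn].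
apply/cvgrPdist_lt => e e0; move: (pp); rewrite ltr_norml => /andP[p1 p2].
(* The midpoints with -pi and pi keep x1 and x2 in the domain of [psi_lt]. *)
pose x1 := Num.max (phi - e) ((phi - pi) / 2).
pose x2 := Num.min (phi + e) ((phi + pi) / 2).
have [x1e x1p] : phi - e <= x1 /\ (phi - pi) / 2 <= x1.
  by rewrite !le_max !lexx orbT.
have [x2e x2p] : x2 <= phi + e /\ x2 <= (phi + pi) / 2.
  by rewrite !ge_min !lexx orbT.
have x1phi : x1 < phi by rewrite gt_max; apply/andP; split; lra.
have phix2 : phi < x2 by rewrite lt_min; apply/andP; split; lra.
have x1pi : `|x1| < pi by rewrite ltr_norml; apply/andP; split; lra.
have x2pi : `|x2| < pi by rewrite ltr_norml; apply/andP; split; lra.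
have n1 : \forall x \near m, psi x1 < ht x / sqn x.
  by apply: (cvgr_gt _ cr); rewrite -pE psi_lt.
have n2 : \forall x \near m, ht x / sqn x < psi x2.
  by apply: (cvgr_lt _ cr); rewrite -pE psi_lt.
near=> x; have [ap aE] := angleP x.
have l1 : x1 < angle x.
  have h : psi x1 < psi (angle x) by rewrite aE; near: x.
  rewrite ltNge le_eqVlt; apply/negP => /predU1P[E|H].
    by rewrite E ltxx in h.
  by have := lt_trans h (psi_lt ap x1pi H); rewrite ltxx.
have l2 : angle x < x2.
  have h : psi (angle x) < psi x2 by rewrite aE; near: x.
  rewrite ltNge le_eqVlt; apply/negP => /predU1P[E|H].
    by rewrite -E ltxx in h.
  by have := lt_trans h (psi_lt x2pi ap H); rewrite ltxx.
by rewrite ltr_norml; apply/andP; split; lra.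
Unshelve. all: by end_near. Qed.

Lemma cc_distE q p : (0 < n)%N -> sqn (ldiv q p) != 0 ->
  cc_dist q p = Num.sqrt (gaveau (angle (ldiv q p)) (ldiv q p)).
Proof.
move=> n0 m0; have [pp pE] := angleP (ldiv q p).
by rewrite -(cc_dist_sqr n0 m0 pp pE) sqrtr_sqr ger0_norm ?cc_dist_ge0.
Qed.

Lemma cvg_gaveau {T : Type} (F : set_system T) {FF : Filter F}
    (a : T -> R) (f : T -> heis R n) phi m : `|phi| < pi ->
  a @ F --> phi -> f @ F --> m -> gaveau (a x) (f x) @[x --> F] --> gaveau phi
    m.
Proof.
move=> pp ca cf; apply: cvgD.
  by apply: cvgM; [apply: cvgM => //; exact: cvg_cst|exact: cvg_ht].
apply: cvgM; last exact: cvg_sqn.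
by apply: (cvg_comp _ _ ca); exact: continuous_chi.
Qed.

Section Filtered.
Context {T : Type} (F : set_system T) {FF : Filter F} (f g : T -> heis R n) (q
  p : heis R n).
Context (n0 : (0 < n)%N) (m0 : sqn (ldiv q p) != 0).
Context (fq : f @ F --> q) (gp : g @ F --> p).

Lemma near_sqn_neq0 : \forall x \near F, sqn (ldiv (f x) (g x)) != 0.
Proof. by apply: cvgr_neq0 m0; apply: cvg_sqn; exact: cvg_ldiv. Qed.

Lemma cvg_angle_ldiv :
  angle (ldiv (f x) (g x)) @[x --> F] --> angle (ldiv q p).
Proof.
by apply: (@cvg_comp _ _ _ (fun x => ldiv (f x) (g x)) angle _ (nbhs (ldiv q
  p)));
  [exact: cvg_ldiv|exact: cvg_angle].
Qed.

Lemma cvg_cc_dist : cc_dist (f x) (g x) @[x --> F] --> cc_dist q p.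
Proof.
rewrite cc_distE//.
have E : \forall x \near F,
    Num.sqrt (gaveau (angle (ldiv (f x) (g x))) (ldiv (f x) (g x))) =
    cc_dist (f x) (g x).
  by apply: filterS near_sqn_neq0 => x x0; rewrite cc_distE.
apply: cvg_trans; first exact: (near_eq_cvg E).
apply: (@cvg_comp _ _ _ _ Num.sqrt _
  (nbhs (gaveau (angle (ldiv q p)) (ldiv q p)))); last exact: sqrt_continuous.
by apply: cvg_gaveau; [exact: (angleP _).1|exact: cvg_angle_ldiv|exact:
  cvg_ldiv].
Qed.

Lemma cvg_init_dir : init_dir (f x) (g x) @[x --> F] --> init_dir q p.
Proof.
have cm : ldiv (f x) (g x) @[x --> F] --> ldiv q p by exact: cvg_ldiv.
have ca := cvg_angle_ldiv.
have cJ : hrot (ldiv (f x) (g x)) @[x --> F] --> hrot (ldiv q p).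
  apply: cvg_heis; [exact: cvg_y|apply: cvgN; exact: cvg_x|exact: cvg_cst].
have d0 : cc_dist q p != 0.
  apply: contra_neq m0 => d0; apply/eqP; rewrite eq_le sqn_ge0 andbT.
  by have := sqn_le_cc_dist q p n0; rewrite d0 expr0n.
set W := fun x => (cc_dist (f x) (g x))^-1 *:
  (chi (angle (ldiv (f x) (g x))) *: ldiv (f x) (g x)
   - angle (ldiv (f x) (g x)) *: hrot (ldiv (f x) (g x))).
have cW : W x @[x --> F] --> (cc_dist q p)^-1 *:
  (chi (angle (ldiv q p)) *: ldiv q p - angle (ldiv q p) *: hrot (ldiv q p)).
  apply: cvgZ; first by apply: cvgV => //; exact: cvg_cc_dist.
  apply: cvgB; last exact: cvgZ.
  apply: cvgZ => //; apply: (cvg_comp _ _ ca).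
  by apply: continuous_chi; exact: (angleP _).1.
by apply: cvg_heis; [exact: cvg_x|exact: cvg_y|exact: cvg_sympl].
Qed.

End Filtered.

End Continuity.

(** * Continuity of the nearest-point map *)

Section NearestPoint.
Context {R : realType} {n : nat}.
Implicit Types (p q m v w : heis R n) (phi : R) (E : set (heis R n)).

(** The product p m, inverse to [ldiv p]. *)
Definition hmul p m : heis R n :=
  (p.1.1 + m.1.1, p.1.2 + m.1.2, ht p + ht m + sympl m p).

Lemma hmulK p m : ldiv p (hmul p m) = m.
Proof.
apply: heis_ext => [i|i|]; rewrite ?hx_ldiv ?hy_ldiv ?ht_ldiv.
- by rewrite /hx /= mxE; ring.
- by rewrite /hy /= mxE; ring.
rewrite {1}/hmul {1}/ht /=; suff -> : sympl (hmul p m) p = sympl m p by ring.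
rewrite /sympl; apply: eq_bigr => i _; rewrite /hx /hy /= !mxE; ring.
Qed.

Lemma ldivK p q : hmul p (ldiv p q) = q.
Proof. by apply: (@ldiv_inj _ _ p); rewrite hmulK. Qed.

Lemma cvg_hmul {T : Type} (F : set_system T) {FF : Filter F}
    (f g : T -> heis R n) p m :
  f @ F --> p -> g @ F --> m -> hmul (f x) (g x) @[x --> F] --> hmul p m.
Proof.
move=> fp gm; apply: cvg_heis.
- by apply: cvgD; exact: cvg_x.
- by apply: cvgD; exact: cvg_y.
- apply: cvgD; last exact: cvg_sympl.
  by apply: cvgD; exact: cvg_ht.
Qed.

(** A compact box that contains q^-1 p whenever d(q, p) <= M; see
    [cc_ball_hbox]. *)
Definition hbox (M : R) : set (heis R n) :=
  [set v : 'rV[R]_n | forall i, `[- M, M]%classic (v ord0 i)] `*`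
  [set v : 'rV[R]_n | forall i, `[- M, M]%classic (v ord0 i)] `*`
  `[- M ^+ 2, M ^+ 2]%classic.

Lemma compact_hbox M : compact (hbox M).
Proof.
apply: compact_setX; last exact: segment_compact.
by apply: compact_setX; apply: (@rV_compact R n (fun=> `[- M, M]%classic)) => i;
  exact: segment_compact.
Qed.

Lemma cc_ball_hbox p q M : (0 < n)%N -> 0 <= M -> cc_dist p q <= M ->
  hbox M (ldiv p q).
Proof.
move=> n0 M0 dM; have dM2 : cc_dist p q ^+ 2 <= M ^+ 2.
  by rewrite ler_sqr ?nnegrE ?cc_dist_ge0.
have sM := le_trans (sqn_le_cc_dist p q n0) dM2.
have tM := le_trans (norm_ht_le_cc_dist p q n0) dM2.
have zM i : hx (ldiv p q) i ^+ 2 <= M ^+ 2 /\ hy (ldiv p q) i ^+ 2 <= M ^+ 2.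
  have : hx (ldiv p q) i ^+ 2 + hy (ldiv p q) i ^+ 2 <= M ^+ 2.
    apply: le_trans sM; rewrite /sqn (bigD1 i)//= lerDl.
    by apply: sumr_ge0 => j _; rewrite addr_ge0 ?sqr_ge0.
  by have := sqr_ge0 (hx (ldiv p q) i); have := sqr_ge0 (hy (ldiv p q) i); lra.
have nM (x : R) : x ^+ 2 <= M ^+ 2 -> x \in `[- M, M].
  move=> xM; rewrite in_itv/= -ler_norml -(ger0_norm M0).
  by rewrite -ler_sqr ?nnegrE// -!normrX !ger0_norm ?sqr_ge0.
split; [split => i /=|].
- exact: nM (zM i).1.
- exact: nM (zM i).2.
- rewrite /= in_itv/= -ler_norml; apply: le_trans tM.
  rewrite ler_peMl// (le_trans _ (pi_ge2 R)) ?ler1n//.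
Qed.

(** The squared distance is the supremum of the Gaveau functions, also at
    vertical points, where it is not attained. *)
Lemma lt_gaveau p q (x : R) : (0 < n)%N -> x < cc_dist p q ^+ 2 ->
  exists2 phi, `|phi| < pi & x < gaveau phi (ldiv p q).
Proof.
move=> n0; have pi0 := pi_gt0 R.
have [m0|m0] := eqVneq (sqn (ldiv p q)) 0; last first.
  have [pp pE] := angleP (ldiv p q).
  by rewrite (cc_dist_sqr n0 m0 pp pE) => xd; exists (angle (ldiv p q)).
rewrite cc_dist_sqr_vertical//; set t := ht _ => xt.
have [xn|x0] := ltP x 0.
  exists 0; first by rewrite normr0.
  by rewrite /gaveau m0 !mulr0 mul0r addr0.
have t0 : 0 < `|t|.
  by rewrite normr_gt0; apply: contraTneq xt => ->; rewrite normr0 mulr0 -leNgt.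
have xt' : x / (2 * `|t|) < pi by rewrite ltr_pdivrMr ?mulr_gt0//; lra.
have xt0 : 0 <= x / (2 * `|t|) by rewrite divr_ge0// mulr_ge0.
pose phi := (x / (2 * `|t|) + pi) / 2.
have phip : phi < pi by rewrite /phi; lra.
have phi0 : 0 <= phi by rewrite /phi; lra.
have xphi : x < 2 * phi * `|t|.
  rewrite -ltr_pdivrMr// -ltr_pdivrMl//.
  suff : 2^-1 * (x / `|t|) = x / (2 * `|t|) by rewrite /phi; lra.
  by rewrite invfM; ring.
have [tp|tn] := leP 0 t.
  exists phi; first by rewrite ger0_norm.
  by rewrite /gaveau m0 mulr0 addr0 -/t -(ger0_norm tp).
exists (- phi); first by rewrite normrN ger0_norm.
by rewrite /gaveau m0 mulr0 addr0 -/t mulrN mulNr -mulrN -(ltr0_norm tn).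
Qed.

Lemma xiP E p : Unp E p ->
  nearest E p (xi E p) /\ forall q, nearest E p q -> q = xi E p.
Proof.
move=> [q [nq uq]]; have nx : nearest E p (xi E p).
  exact: (@getI _ [set q | nearest E p q] q).
by split => // q' nq'; rewrite -(uq _ nq') -(uq _ nx).
Qed.

(** The displacements from p' to xi(p') stay in a compact box. Each m in this
    box leads from p to a point which is xi(p), or lies outside of the closed
    set E, or is strictly farther from p than xi(p). In the last case some
    Gaveau function detects the strict inequality, and it persists for
    displacements close to m and points p' close to p. Compactness makes this
    uniform in m. *)
Lemma xi_near E p : (0 < n)%N -> closed E -> Unp E p ->
  sqn (ldiv p (xi E p)) != 0 ->
  forall U, nbhs (xi E p) U -> \forall p' \near p, Unp E p' -> U (xi E p').
Proof.
move=> n0 cE Up m0 U nU; set q := xi E p in m0 nU *.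
have [[Eq qmin] quniq] := xiP Up; rewrite -/q in Eq qmin quniq.
have cq : (fun=> q) @ p --> q by exact: cvg_cst.
have cid : (x : heis R n) @[x --> p] --> p by exact: cvg_id.
(* This is where the displacement from p to q has to be non-vertical. *)
have cd : cc_dist x q @[x --> p] --> cc_dist p q by exact: cvg_cc_dist.
pose M := cc_dist p q + 1.
have nM : \forall p' \near p, cc_dist p' q <= M.
  by near=> p'; apply/ltW; near: p'; apply: (cvgr_lt _ cd); rewrite ltrDl.
have M0 : 0 <= M by rewrite addr_ge0 ?cc_dist_ge0.
have /compact_near_coveringP/(_ _ (nbhs p)
  (fun p' m => E (hmul p' m) -> cc_dist p' (hmul p' m) <= cc_dist p' q ->
     U (hmul p' m)) _) near_box := @compact_hbox M.
have {near_box} : \forall p' \near p, hbox M `<=`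
    (fun m => E (hmul p' m) -> cc_dist p' (hmul p' m) <= cc_dist p' q ->
     U (hmul p' m)).
  apply: near_box => m _.
  have ch : hmul x.2 x.1 @[x --> (m, p)] --> hmul p m.
    by apply: cvg_hmul; [exact: cvg_snd|exact: cvg_fst].
  have [mq|mq] := eqVneq (hmul p m) q.
    have : \forall x \near (m, p), U (hmul x.2 x.1) by apply: ch; rewrite mq.
    by apply: filterS => -[m' p'].
  have [Em|Em] := pselect (E (hmul p m)); last first.
    have : \forall x \near (m, p), (~` E) (hmul x.2 x.1).
      by apply: ch; apply: open_nbhs_nbhs; split => //; exact: closed_openC.
    by apply: filterS => -[m' p'] /= H /H.
  have lt : cc_dist p q < cc_dist p (hmul p m).
    rewrite ltNge; apply/negP => le; move/eqP: mq; apply.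
    by apply: quniq; split => // q' Eq'; apply: le_trans le _; exact: qmin.
  have [phi pp gl] : exists2 phi, `|phi| < pi & cc_dist p q ^+ 2 < gaveau phi m.
    have := @lt_gaveau p (hmul p m) (cc_dist p q ^+ 2) n0; rewrite hmulK; apply.
    by rewrite ltr_sqr ?nnegrE ?cc_dist_ge0.
  have cg : gaveau phi x.1 - cc_dist x.2 q ^+ 2 @[x --> (m, p)] -->
      gaveau phi m - cc_dist p q ^+ 2.
    apply: cvgB.
      by apply: cvg_gaveau => //; [exact: cvg_cst|exact: cvg_fst].
    rewrite expr2; under eq_cvg do rewrite expr2.
    have c2 : cc_dist x.2 q @[x --> (m, p)] --> cc_dist p q.
      by apply: (@cvg_comp _ _ _ snd (fun p => cc_dist p q) _ (nbhs p)) => //;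
        exact: cvg_snd.
    exact: cvgM.
  have : \forall x \near (m, p), 0 < gaveau phi x.1 - cc_dist x.2 q ^+ 2.
    by apply: (cvgr_gt _ cg); rewrite subr_gt0.
  apply: filterS => -[m' p'] /= g0 _ le.
  exfalso; have := gaveau_le_cc_dist p' (hmul p' m') n0 pp; rewrite hmulK => g1.
  have : cc_dist p' (hmul p' m') ^+ 2 <= cc_dist p' q ^+ 2.
    by rewrite ler_sqr ?nnegrE ?cc_dist_ge0.
  by move: g0; rewrite subr_gt0; lra.
apply: filterS2 nM => p' p'M box Up'.
have [[Ex xmin] _] := xiP Up'.
have := box (ldiv p' (xi E p')); rewrite ldivK; apply => //; last exact: xmin.
by apply: cc_ball_hbox => //; apply: le_trans p'M; exact: xmin.
Unshelve. all: by end_near. Qed.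

End NearestPoint.

(** * Points vertically above their nearest point *)

Section VerticalPoints.
Context {R : realType} {n : nat}.
Implicit Types (p q m v w : heis R n) (E : set (heis R n)).

Lemma riem_T_field q v : riem q v (T_field q) = T_coord q v.
Proof.
rewrite /riem T_coord_T mulr1 !big1 ?addr0 ?add0r// => i _.
  by rewrite /hy /= mxE mulr0.
by rewrite /hx /= mxE mulr0.
Qed.

Lemma continuous_T_coord q : continuous (@T_coord R n q).
Proof.
move=> v; have cid : (x : heis R n) @[x --> v] --> v by exact: cvg_id.
have cq : (fun=> q) @ v --> q by exact: cvg_cst.
by apply: cvgB; [exact: cvg_ht|exact: cvg_sympl].
Qed.

Lemma derive_gt0_near_right (f : R -> R) (d : R) :
  is_derive (0 : R) 1 f d -> f 0 = 0 -> 0 < d -> \forall h \near (0 : R)^'+, 0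
    < f h.
Proof.
move=> [df fd] f0 d0.
have cf : h^-1 *: ((f \o shift 0) (h *: 1) - f 0) @[h --> (0 : R)^'] --> d.
  by rewrite -fd; exact: df.
have nq := cvgr_gt _ (cvg_dnbhs_at_right cf) 0 d0.
near=> h; have h0 : 0 < h by near: h; exact: nbhs_right_gt.
have : 0 < h^-1 *: ((f \o shift 0) (h *: 1) - f 0).
  near: h; exact: nq.
rewrite f0 subr0 /= addr0 /GRing.scale /= mulr1.
by rewrite pmulr_rgt0// invr_gt0.
Unshelve. all: by end_near. Qed.

(** Let e be the sign of the vertical displacement t from q to p. If the
    derivative had positive vertical component in the direction e, then along
    the curve 2 pi |t| would decrease to first order, while |Z|^2, which bounds
    the remaining part of the squared distance to p, is of second order; so the
    curve would come closer to p than q. *)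
Lemma vertical_tangent (e : R) E p v : (0 < n)%N -> ~ E p ->
  nearest E p (xi E p) -> sqn (ldiv (xi E p) p) = 0 ->
  e * ht (ldiv (xi E p) p) = `|ht (ldiv (xi E p) p)| -> e ^+ 2 = 1 ->
  tangent_vectors E (xi E p) v -> e * T_coord (xi E p) v <= 0.
Proof.
set q := xi E p => n0 nEp [Eq qmin] m0 eE e2 [g [r [[gD _] r0 g0 gE vE]]].
rewrite leNgt; apply/negP => Tpos; have pi0 := pi_gt0 R.
set t0 := ht (ldiv q p) in eE.
have zm i : hx p i = hx q i /\ hy p i = hy q i.
  have [] := sqn_eq0 m0 i; rewrite hx_ldiv hy_ldiv => /eqP + /eqP.
  by rewrite !subr_eq0 => /eqP-> /eqP->.
have dg : is_derive (0 : R) 1 g v by rewrite vE derive1E; exact: derivableP.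
have d1 := is_derive_ht_ldiv q dg; have d2 := is_derive_sqn_ldiv q dg.
rewrite (_ : 2 * _ = 0) in d2; last first.
  rewrite g0 big1 ?mulr0// => i _.
  by have [-> ->] := sqn_eq0 (sqn_ldivv q) i; rewrite !mul0r addr0.
(* f h is a lower bound of d(q, p)^2 - d(g h, p)^2 for small h. *)
pose f h := 2 * pi * (e * ht (ldiv q (g h))) - sqn (ldiv q (g h)).
have df : is_derive (0 : R) 1 f (2 * pi * (e * T_coord q v)).
  by apply: is_derive_eq; rewrite /GRing.scale/= subr0.
have f0 : f 0 = 0 by rewrite /f g0 sqn_ldivv ht_ldivv !mulr0 subrr.
have dpos : 0 < 2 * pi * (e * T_coord q v).
  by apply: mulr_gt0 => //; rewrite mulr_gt0.
have fp := derive_gt0_near_right df f0 dpos.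
have t0n : 0 < `|t0|.
  rewrite normr_gt0; apply/negP => /eqP t00; apply: nEp.
  suff -> : p = q by [].
  apply: (@ldiv_inj _ _ q); apply: heis_ext => [i|i|].
  - by rewrite !hx_ldiv (zm i).1.
  - by rewrite !hy_ldiv (zm i).2.
  - by rewrite -/t0 t00 ht_ldivv.
have cg : g @ (0 : R) --> q.
  rewrite -g0; apply: differentiable_continuous; apply/derivable1_diffP;
    exact: gD.
have ct : e * ht (ldiv q (g h)) @[h --> (0 : R)^'+] --> (0 : R).
  have cq : (fun=> q) @ (0 : R) --> q by exact: cvg_cst.
  have c1 : e * ht (ldiv q (g h)) @[h --> (0 : R)] --> e * ht (ldiv q q).
    by apply: cvgM; [exact: cvg_cst|exact: cvg_ht (cvg_ldiv cq cg)].
  by rewrite ht_ldivv mulr0 in c1; exact: cvg_at_right_filter.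
have nt := cvgr_lt _ ct _ t0n.
have nh : \forall h \near (0 : R)^'+,
    ((0 < f h /\ e * ht (ldiv q (g h)) < `|t0|) /\ 0 < h) /\ h < r.
  near=> h; split; [split; [split|]|]; near: h.
  - exact: fp.
  - exact: nt.
  - exact: nbhs_right_gt.
  - exact: nbhs_right_lt.
have [h [[[fh th] h0] hr]] := @filter_ex _ _ (at_right_proper_filter 0) _ nh.
have Egh : E (g h) by apply: gE; rewrite hr ltW.
have sE : sqn (ldiv (g h) p) = sqn (ldiv q (g h)).
  rewrite (sqn_ldivC p); apply: eq_bigr => i _.
  by rewrite !hx_ldiv !hy_ldiv (zm i).1 (zm i).2.
have tE : ht (ldiv (g h) p) = t0 - ht (ldiv q (g h)).
  rewrite /t0 (ht_ldivM q (g h) p) (_ : sympl _ _ = 0); first by ring.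
  by apply: big1 => i _; rewrite !hx_ldiv !hy_ldiv (zm i).1 (zm i).2; ring.
have e0 : `|e| = 1 by apply/eqP;
  rewrite -(@eqrXn2 _ 2)// -normrX e2 normr1 expr1n.
have nE : `|ht (ldiv (g h) p)| = `|t0| - e * ht (ldiv q (g h)).
  rewrite -[LHS]mul1r -e0 -normrM tE mulrBr eE ger0_norm// subr_ge0.
  exact: ltW.
have := cc_dist_sqr_le (g h) p n0; rewrite nE sE.
have := cc_dist_sqr_vertical n0 m0; rewrite -/t0.
have : cc_dist q p ^+ 2 <= cc_dist (g h) p ^+ 2.
  by rewrite ler_sqr ?nnegrE ?cc_dist_ge0// !(cc_distC _ p n0) qmin.
by move: fh; rewrite /f; lra.
Unshelve. all: by end_near. Qed.

(** The half-spaces are closed, so [vertical_tangent] extends from the tangent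
    vectors of curves to the tangent cone. *)
Lemma vertical_singular E p : (0 < n)%N -> ~ E p ->
  nearest E p (xi E p) -> sqn (ldiv (xi E p) p) = 0 -> singular E (xi E p).
Proof.
set q := xi E p => n0 nEp nq m0.
have Tcl (e : R) : (forall v, tangent_vectors E q v -> e * T_coord q v <= 0) ->
    forall v, Tan E q v -> e * T_coord q v <= 0.
  move=> H v [->|cv].
    by rewrite /T_coord /ht /= big1 ?subr0 ?mulr0// => i _;
      rewrite /hx /hy /= !mxE; ring.
  have : closed [set v | e * T_coord q v <= 0].
    apply: (@closed_comp _ _ (fun v => e * T_coord q v) [set x : R | x <= 0]).
      move=> x _; apply: cvgM; first exact: cvg_cst.
      exact: continuous_T_coord.
    exact: closed_le.
  apply; exact: (closureS H).
split; first by have [] := nq.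
have [t0|t0] := leP 0 (ht (ldiv q p)).
  right => v Tv; rewrite /lower_half_space/= riem_T_field.
  rewrite -[T_coord q v]mul1r; apply: (Tcl 1) => // w.
  by apply: vertical_tangent => //; rewrite ?mul1r ?expr1n// ger0_norm.
left => v Tv; rewrite /upper_half_space/= riem_T_field -oppr_le0 -mulN1r.
apply: (Tcl (-1)) => // w.
by apply: vertical_tangent => //; rewrite ?mulN1r ?sqrrN ?expr1n// ltr0_norm.
Qed.

Lemma regular_nonvertical E p : (0 < n)%N -> Unp E p -> ~ E p ->
  regular E (xi E p) -> sqn (ldiv (xi E p) p) != 0.
Proof.
move=> n0 Up nEp [_ nsing]; apply/eqP => m0; apply: nsing.
by apply: vertical_singular => //; exact: (xiP Up).1.
Qed.

End VerticalPoints.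

(** * Convergence of initial vectors *)

Section Main.
Context {R : realType} {n : nat}.
Implicit Types (p q : heis R n) (E : set (heis R n)).

Lemma init_vecE E p : (0 < n)%N -> sqn (ldiv (xi E p) p) != 0 ->
  init_vec E p = (xi E p, init_dir (xi E p) p).
Proof.
move=> n0 m0; apply: initial_tangentE => //.
have [g gm] := minimizing_geodesic_ex n0 m0.
exact: (@getI _ [set g | minimizing_geodesic (xi E p) p g] g).
Qed.

(** Stated for an arbitrary filter, so that it applies to sequences of base
    points and to the continuity of [init_vec] within a set. *)
Lemma cvg_initial_tangent E (T : Type) (F : set_system T) {FF : Filter F}
    (f : T -> heis R n) (V : T -> tangent_bundle R n) p :
  (0 < n)%N -> closed E -> Unp E p -> ~ E p -> regular E (xi E p) ->
  f @ F --> p -> (\forall x \near F, Unp E (f x)) ->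
  (forall x, sqn (ldiv (xi E (f x)) (f x)) != 0 ->
     V x = (xi E (f x), init_dir (xi E (f x)) (f x))) ->
  V @ F --> init_vec E p.
Proof.
move=> n0 cE Up nEp reg fp Uf VE.
have m0 := regular_nonvertical n0 Up nEp reg.
have cxi : xi E (f x) @[x --> F] --> xi E p.
  move=> U nU; have m0' : sqn (ldiv p (xi E p)) != 0 by rewrite sqn_ldivC.
  have := fp _ (xi_near n0 cE Up m0' nU).
  by apply: filterS2 Uf => x Ux; apply.
rewrite init_vecE//.
have E1 : \forall x \near F, (xi E (f x), init_dir (xi E (f x)) (f x)) = V x.
  have nz : \forall x \near F, sqn (ldiv (xi E (f x)) (f x)) != 0.
    exact: near_sqn_neq0 m0 cxi fp.
  by apply: filterS nz => x x0; rewrite VE.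
apply: cvg_trans; first exact: (near_eq_cvg E1).
exact: (cvg_pair cxi (cvg_init_dir n0 m0 cxi fp)).
Qed.

End Main.

Theorem proposition3p6 (R : realType) (n : nat) (hn : (1 <= n)%N)
    (E : set (heis R n)) (hE : closed E) :
  (forall (p_ : nat -> heis R n) (p : heis R n) (v_ : nat -> tangent_bundle R n),
     (forall i, (Unp E `\` E) (p_ i)) ->
     (Unp E `\` E) p ->
     p_ i @[i --> \oo] --> p ->
     regular E (xi E p) ->
     (forall i, exists2 g, minimizing_geodesic (xi E (p_ i)) (p_ i) g &
                           v_ i = initial_tangent g) ->
     v_ i @[i --> \oo] --> init_vec E p)
  /\
  {within (Unp E `&` xi E @^-1` (frontier E `\` S0 E)) `\` E,
     continuous (init_vec E)}.
Proof.
split.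
  move=> p_ p v_ Up_ [Up nEp] pp reg vg.
  apply: (@cvg_initial_tangent R n E _ _ _ p_) => //.
    by near=> i; have [] := Up_ i.
  move=> i m0; have [g gm ->] := vg i.
  by rewrite (initial_tangentE hn m0 gm).
apply/subspace_continuousP => p [[Up [Fp nS]] nEp].
have reg : regular E (xi E p).
  by split; [have [[]] := xiP Up|move=> sing; apply: nS].
apply: (@cvg_initial_tangent R n E _ _ _ id) => //.
- exact: cvg_within.
- have : within ((Unp E `&` xi E @^-1` (frontier E `\` S0 E)) `\` E) (nbhs p)
      ((Unp E `&` xi E @^-1` (frontier E `\` S0 E)) `\` E) by exact: withinT.
  by apply: filterS => x [[]].
- by move=> x m0; exact: init_vecE.
Unshelve. all: by end_near. Qed.
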